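(* Let $\varphi:\Sigma\to\mathbb{R}$ be a continuous real-valued potential which is not cohomologous to a constant. Then the packing spectrum $\alpha\mapsto\dim_{\mathcal P}\Pi(J_\varphi(\alpha))$ is concave and continuous on the interval $A(\varphi)=[\alpha_{\min},\alpha_{\max}]$.
   Context: Let $a_1>a_2>\cdots>a_d\ge2$ be natural numbers, $\mathcal{D}\subseteq\prod_{q=1}^d\{0,\dots,a_q-1\}$ a digit set, $\Sigma=\mathcal{D}^{\mathbb{N}}$ with the product topology, and $\sigma:\Sigma\to\Sigma$ the left shift. The map $\Pi:\Sigma\to\mathbb{T}^d=\mathbb{R}^d/\mathbb{Z}^d$ is $\Pi((\omega_\nu)_{\nu\in\mathbb{N}})=\left(\sum_{\nu\in\mathbb{N}}i_j(\nu)a_j^{-\nu}\right)_{j=1}^d$ where $\omega_\nu=(i_j(\nu))_{j=1}^d$; its image $\Lambda$ is the self-affine Sierpiński sponge. $\mathcal{M}_\sigma(\Sigma)$ is the set of $\sigma$-invariant Borel probability measures on $\Sigma$. $J_\varphi(\alpha)=\{\omega\in\Sigma:\lim_{n\to\infty}\frac1n\sum_{l=0}^{n-1}\varphi(\sigma^l\omega)=\alpha\}$; $A(\varphi)=\{\int\varphi\,d\mu:\mu\in\mathcal{M}_\sigma(\Sigma)\}$, with minimum $\alpha_{\min}$ and maximum $\alpha_{\max}$. $\varphi$ is cohomologous to a constant if $\varphi=c+u-u\circ\sigma$ for some $c\in\mathbb{R}$ and continuous $u:\Sigma\to\mathbb{R}$. $\dim_{\mathcal P}$ denotes packing dimension.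 *)

(* Defs.v *)
From HB Require Import structures.
From mathcomp Require Import all_boot all_order all_algebra.
From mathcomp Require Import generic_quotient ring_quotient.
From mathcomp Require Import all_classical all_reals all_analysis.
From mathcomp Require Import ring lra zify.
Import Order.TTheory GRing.Theory Num.Theory.
Import numFieldNormedType.Exports.

Set Implicit Arguments.
Unset Strict Implicit.
Unset Printing Implicit Defensive.

Local Open Scope classical_set_scope.
Local Open Scope ring_scope.

Section PackingDimension.
Context {R : realType} {T : metricType R}.
Implicit Types (E : set T) (s delta : R).

Definition mclosed_ball (x : T) (r : R) : set T := [set y | mdist x y <= r].

(* The family indexed by I consists of pairwise disjoint closed balls centred
   in E, with radii at most delta. I : set nat may be finite or infinite. *)
Definition is_packing E delta (I : set nat) (c : nat -> T) (r : nat -> R) :=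
  (forall i, I i -> E (c i) /\ 0 < r i <= delta) /\
  trivIset I (fun i => mclosed_ball (c i) (r i)).

(* 2 r_i is the diameter of a Euclidean (or small toral) ball of radius r_i. *)
Definition packing_sum s (I : set nat) (r : nat -> R) : \bar R :=
  (\esum_(i in I) ((2 * r i) `^ s)%:E)%E.

Definition packing_premeasure_delta s delta E : \bar R :=
  ereal_sup [set x | exists I c r,
    is_packing E delta I c r /\ x = packing_sum s I r].

(* packing_premeasure_delta is monotone in delta, so this infimum is its limit
   as delta tends to 0. *)
Definition packing_premeasure s E : \bar R :=
  ereal_inf [set packing_premeasure_delta s delta E | delta in [set x | 0 < x]].

Definition packing_measure s E : \bar R :=
  ereal_inf [set (\sum_(0 <= i <oo) packing_premeasure s (F i))%E |
             F in [set F : nat -> set T | E `<=` \bigcup_i F i]].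

Definition packing_dim E : \bar R :=
  ereal_inf [set s%:E | s in [set s | 0 <= s /\ packing_measure s E = 0%E]].

End PackingDimension.

Definition concave_function (R : realType) (A : set R) (f : R -> R) : Prop :=
  @convex_function R R^o A (fun x => - f x).

Definition enorm {R : realType} {d : nat} (x : 'rV[R]_d) : R :=
  Num.sqrt (\sum_j x ord0 j ^+ 2).

Section EuclideanNorm.
Context {R : realType} {d : nat}.
Implicit Types x y : 'rV[R]_d.

Lemma enorm_ge0 x : 0 <= enorm x.
Proof. exact: sqrtr_ge0. Qed.

Lemma enorm0 : enorm (0 : 'rV[R]_d) = 0.
Proof. by rewrite /enorm big1 ?sqrtr0// => j _; rewrite mxE expr0n. Qed.

Lemma enormN x : enorm (- x) = enorm x.
Proof. by congr Num.sqrt; apply: eq_bigr => j _; rewrite mxE sqrrN. Qed.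

Lemma le_coord_enorm x j : `|x ord0 j| <= enorm x.
Proof.
rewrite -sqrtr_sqr ler_wsqrtr// (bigD1 j)//= lerDl.
by apply: sumr_ge0 => k _; exact: sqr_ge0.
Qed.

Lemma sum_sqr_ge0 x : 0 <= \sum_j x ord0 j ^+ 2.
Proof. by apply: sumr_ge0 => j _; exact: sqr_ge0. Qed.

Lemma enorm_sqr x : enorm x ^+ 2 = \sum_j x ord0 j ^+ 2.
Proof. by rewrite sqr_sqrtr// sum_sqr_ge0. Qed.

Lemma enorm_eq0 x : enorm x = 0 -> x = 0.
Proof.
move=> x0; apply/rowP => j; rewrite mxE; apply/eqP.
by rewrite -normr_le0 -x0 le_coord_enorm.
Qed.

Lemma cauchy_schwarz x y :
  \sum_j x ord0 j * y ord0 j <= enorm x * enorm y.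
Proof.
have [/eqP x0|x0] := eqVneq (enorm x) 0.
  rewrite (enorm_eq0 (eqP x0)) enorm0 mul0r big1// => j _.
  by rewrite mxE mul0r.
have [/eqP y0|y0] := eqVneq (enorm y) 0.
  rewrite (enorm_eq0 (eqP y0)) enorm0 mulr0 big1// => j _.
  by rewrite mxE mulr0.
have xy0 : 0 < enorm x * enorm y by rewrite mulr_gt0// lt0r ?x0 ?y0 enorm_ge0.
rewrite -(ler_pM2l xy0).
have : 0 <= \sum_j (enorm y * x ord0 j - enorm x * y ord0 j) ^+ 2.
  by apply: sumr_ge0 => j _; exact: sqr_ge0.
have -> : \sum_j (enorm y * x ord0 j - enorm x * y ord0 j) ^+ 2 =
    enorm y ^+ 2 * \sum_j x ord0 j ^+ 2
    - 2 * (enorm x * enorm y) * \sum_j x ord0 j * y ord0 j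
    + enorm x ^+ 2 * \sum_j y ord0 j ^+ 2.
  rewrite !mulr_sumr -sumrB -big_split/=.
  by apply: eq_bigr => j _; ring.
rewrite -!enorm_sqr.
set S := \sum_j _; set u := enorm x; set v := enorm y => h.
lra.
Qed.

Lemma enormD x y : enorm (x + y) <= enorm x + enorm y.
Proof.
rewrite -(@ler_pXn2r _ 2)// ?nnegrE ?addr_ge0 ?enorm_ge0//.
have -> : enorm (x + y) ^+ 2 =
    enorm x ^+ 2 + 2 * (\sum_j x ord0 j * y ord0 j) + enorm y ^+ 2.
  rewrite !enorm_sqr mulr_sumr -!big_split/=.
  by apply: eq_bigr => j _; rewrite mxE; ring.
have := cauchy_schwarz x y; set S := \sum_j _ => ?.
lra.
Qed.

End EuclideanNorm.

Definition int_lattice (R : realType) (d : nat) : {pred 'rV[R]_d} :=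
  fun x => [forall j, x ord0 j \is a Num.int].

Lemma int_lattice_zmod_closed (R : realType) (d : nat) :
  zmod_closed (@int_lattice R d).
Proof.
split=> [|x y /forallP xZ /forallP yZ]; apply/forallP => j; rewrite !mxE//.
by rewrite rpredB.
Qed.

HB.instance Definition _ (R : realType) (d : nat) :=
  GRing.isZmodClosed.Build 'rV[R]_d (@int_lattice R d)
    (@int_lattice_zmod_closed R d).

Definition torus (R : realType) (d : nat) : Type :=
  Quotient.quot (@int_lattice R d).

HB.instance Definition _ R d := GRing.Zmodule.on (torus R d).
HB.instance Definition _ R d := Choice.on (torus R d).

Definition torus_proj {R : realType} {d : nat} (x : 'rV[R]_d) : torus R d :=
  \pi_(torus R d)%qT x.

Definition torus_norm {R : realType} {d : nat} (p : torus R d) : R :=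
  inf [set enorm x | x in [set x | torus_proj x = p]].

Section TorusMetric.
Context {R : realType} {d : nat}.
Implicit Types (x y : 'rV[R]_d) (p q : torus R d).

Lemma torus_projD : {morph @torus_proj R d : x y / x + y}.
Proof. by move=> x y; rewrite /torus_proj pi_addr. Qed.

Lemma torus_projN : {morph @torus_proj R d : x / - x}.
Proof. by move=> x; rewrite /torus_proj pi_oppr. Qed.

Lemma torus_proj0 : torus_proj (0 : 'rV[R]_d) = 0.
Proof. by rewrite /torus_proj pi_zeror. Qed.

Lemma torus_projP x y :
  torus_proj x = torus_proj y <-> forall j, x ord0 j - y ord0 j \is a Num.int.
Proof.
split=> [/eqP|xy].
  rewrite /torus_proj -Quotient.idealrBE => /forallP + j => /(_ j).
  by rewrite !mxE.
apply/eqP; rewrite /torus_proj -Quotient.idealrBE; apply/forallP => j.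
by rewrite !mxE.
Qed.

Lemma torus_proj_surj p : exists x, torus_proj x = p.
Proof. by exists (repr p); rewrite /torus_proj reprK. Qed.

Lemma torus_norm_ge0 p : 0 <= torus_norm p.
Proof.
have [x xp] := torus_proj_surj p.
apply: lb_le_inf; first by exists (enorm x), x.
by move=> _ [y _ <-]; exact: enorm_ge0.
Qed.

Lemma torus_norm_le x : torus_norm (torus_proj x) <= enorm x.
Proof.
apply: ge_inf; last by exists x.
by exists 0 => _ [y _ <-]; exact: enorm_ge0.
Qed.

Lemma torus_normN p : torus_norm (- p) = torus_norm p.
Proof.
congr inf; apply/seteqP; split=> _ [x /= xp <-]; exists (- x).
- by rewrite /= torus_projN xp opprK.
- by rewrite enormN.
- by rewrite /= torus_projN xp.
- by rewrite enormN.
Qed.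

Lemma torus_normD p q : torus_norm (p + q) <= torus_norm p + torus_norm q.
Proof.
have [x0 x0p] := torus_proj_surj p; have [y0 y0q] := torus_proj_surj q.
rewrite -lerBlDr; apply: lb_le_inf; first by exists (enorm x0), x0.
move=> _ [x /= xp <-]; rewrite lerBlDr -lerBlDl.
apply: lb_le_inf; first by exists (enorm y0), y0.
move=> _ [y /= yq <-]; rewrite lerBlDl.
by rewrite -xp -yq -torus_projD (le_trans (torus_norm_le _))// enormD.
Qed.

Lemma torus_norm0 : torus_norm (0 : torus R d) = 0.
Proof.
apply/eqP; rewrite eq_le torus_norm_ge0 andbT -torus_proj0.
by rewrite (le_trans (torus_norm_le _))// enorm0.
Qed.

Lemma torus_norm_eq0 p : torus_norm p = 0 -> p = 0.
Proof.
have [x <-] := torus_proj_surj p; rewrite -torus_proj0 => x0.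
apply/torus_projP => j; rewrite mxE subr0; apply: contrapT => /negP xj.
pose c := x ord0 j; pose f : R := (Num.floor c)%:~R.
have fc : f < c.
  rewrite lt_neqAle floor_le andbT; apply: contra xj => /eqP fc.
  by rewrite -/c -fc intr_int.
have cf : c < f + 1 by rewrite /f -[1]/(1%:~R) -intrD floorD1_gt.
pose e := Num.min (c - f) (f + 1 - c).
have e0 : 0 < e by rewrite lt_min !subr_gt0 fc.
suff : e <= torus_norm (torus_proj x) by rewrite x0 leNgt e0.
apply: lb_le_inf; first by exists (enorm x), x.
move=> _ [y /= /torus_projP/(_ j) yx <-].
apply: le_trans (le_coord_enorm y j).
have /intrP[m ym] := yx.
have {}ym : y ord0 j = c + m%:~R by rewrite -ym addrC subrK.
rewrite ym ge_min.
have [mf|mf] := leP (- Num.floor c) m.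
  apply/orP; left; rewrite (le_trans _ (ler_norm _))// lerD2l.
  by rewrite /f -mulrNz ler_int.
apply/orP; right; rewrite -normrN (le_trans _ (ler_norm _))//.
have : f + 1 <= - m%:~R.
  rewrite /f -[1]/(1%:~R) -intrD -mulrNz ler_int; lia.
lra.
Qed.

End TorusMetric.

Section TorusMetricInstance.
Variables (R : realType) (d : nat).
Let dist (p q : torus R d) : R := torus_norm (p - q).

Let distxx p : dist p p = 0.
Proof. by rewrite /dist subrr torus_norm0. Qed.

Let dist_positivity p q : dist p q = 0 -> p = q.
Proof. by move=> /torus_norm_eq0/eqP; rewrite subr_eq0 => /eqP. Qed.

Let dist_sym p q : dist p q = dist q p.
Proof. by rewrite /dist -opprB torus_normN. Qed.

Let dist_triangle q p r : dist p r <= dist p q + dist q r.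
Proof. by rewrite /dist -(subrKA q p (- r)) torus_normD. Qed.

HB.instance Definition _ := isMetric.Build R (torus R d)
  distxx dist_positivity dist_sym dist_triangle.
End TorusMetricInstance.


(* A measurableType is pointed, hence the nonemptiness proof D0. *)
Definition alphabet (d : nat) (a : 'I_d -> nat)
    (D : {set {dffun forall q : 'I_d, 'I_(a q)}}) (D0 : D != finset.set0) :
  Type := {i | i \in D}.

Section AlphabetInstances.
Variables (d : nat) (a : 'I_d -> nat).
Variables (D : {set {dffun forall q : 'I_d, 'I_(a q)}}).
Variable D0 : D != finset.set0.

HB.instance Definition _ := Finite.on (alphabet D0).

Fact alphabet_inhabited : exists i, i \in D.
Proof. exact/set0Pn. Qed.

HB.instance Definition _ := isPointed.Build (alphabet D0)
  (exist _ (xchoose alphabet_inhabited) (xchooseP alphabet_inhabited)).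

End AlphabetInstances.

Section Sponge.
Context {R : realType} {d : nat} {a : 'I_d -> nat}.
Context {D : {set {dffun forall q : 'I_d, 'I_(a q)}}}.
Variable D0 : D != finset.set0.

Definition symbolic_space : Type :=
  prod_topology (fun _ : nat => discrete_topology (alphabet D0)).

HB.instance Definition _ := Pointed.on symbolic_space.
HB.instance Definition _ := Topological.on symbolic_space.

Local Notation Sigma := symbolic_space.

Definition shift (w : Sigma) : Sigma := fun n => w n.+1.

Definition borel_symbolic_space := g_sigma_algebraType (@open Sigma).

Definition shift_invariant : set (probability borel_symbolic_space R) :=
  [set mu | forall B : set borel_symbolic_space, measurable B ->
    mu (shift @^-1` B) = mu B].

Definition digit (w : Sigma) (n : nat) (j : 'I_d) : nat :=
  (val (w n : alphabet D0) : {dffun forall q : 'I_d, 'I_(a q)}) j.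

(* Positions in a word are numbered from 0, so that position n carries the
   weight a_j ^ -(n + 1). *)
Definition coding_map (w : Sigma) : torus R d :=
  torus_proj (\row_j limn (series
    (fun n => (digit w n j)%:R / (a j)%:R ^+ n.+1 : R))).

Definition birkhoff_level_set (phi : Sigma -> R) (alpha : R) : set Sigma :=
  [set w | (n%:R^-1 * \sum_(l < n) phi (iter l shift w)) @[n --> \oo]
           --> alpha].

Definition integral_set (phi : Sigma -> R) : set R :=
  [set (\int[mu]_w phi w)%R | mu in shift_invariant].

(* integral_set is a nonempty compact interval for continuous phi, so that inf
   and sup are its minimum and maximum. *)
Definition alpha_min (phi : Sigma -> R) : R := inf (integral_set phi).
Definition alpha_max (phi : Sigma -> R) : R := sup (integral_set phi).

Definition cohomologous_to_constant (phi : Sigma -> R) : Prop :=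
  exists (c : R) (u : Sigma -> R),
    continuous u /\ forall w, phi w = c + u w - u (shift w).

Definition packing_spectrum (phi : Sigma -> R) (alpha : R) : \bar R :=
  packing_dim (coding_map @` birkhoff_level_set phi alpha).

End Sponge.

(* Main.v *)
Require Import Defs.
From HB Require Import structures.
From mathcomp Require Import all_boot all_order all_algebra finmap.
From mathcomp Require Import all_classical all_reals all_analysis.
From mathcomp Require Import measurable_realfun ring lra zify.
Import Order.TTheory GRing.Theory Num.Theory.
Import numFieldNormedType.Exports.

Set Implicit Arguments.
Unset Strict Implicit.
Unset Printing Implicit Defensive.

Local Open Scope classical_set_scope.
Local Open Scope ring_scope.

(** The number of codes of a sponge at a given scale factors over the strips of
    positions in which the same coordinates are visible. On the level set of
    Birkhoff averages equal to alpha, the average over every strip tends to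
    alpha. This is the only constraint that survives for the packing dimension,
    which depends on counting at infinitely many, possibly sparse, scales: at
    such a scale the words in the different strips can be chosen independently
    of each other. This gives [packing_spectrumE]: the spectrum at alpha is
      [\sum_q strip_weight q * level_entropy phi (forget_below q) alpha],
    where [level_entropy] is the growth rate of the number of projected words
    with average close to alpha. The theorem then reduces to properties of the
    entropies. They are concave, because words with averages alpha and beta can
    be concatenated in any proportion ([level_rate_mix]), and upper
    semicontinuous, because their definition tolerates a small error in the
    average ([level_entropy_usc]); a nonnegative concave function on an interval
    is also lower semicontinuous, up to the endpoints
    ([concave_usc_continuous]).

    For the upper bound, the level set is covered by countably many sets on
    which the averages settle at a known time. The number of codes on such a set
    is at most the product of the numbers of words in the strips
    ([birkhoff_level_cover]).

    For the lower bound, words have to be concatenated, so their deviation from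
    alpha must be under control at all times, up to a constant ([steady_word]);
    by [steady_count] such words still realize every growth rate below the
    entropy. The usual argument via the Baire category theorem on a compact
    subset becomes a direct construction ([birkhoff_level_not_covered]). Given
    countably many sets with few codes, a word is extended stage by stage by
    steady words, through all strips of a very small scale. There are more such
    extensions than codes in the set considered at this stage, so one of them
    has a cylinder that avoids the set. The limit of the words is a point of the
    level set outside all the sets.

    The translation between numbers of codes and packing measures is
    [packing_dim_codes]. It requires that points with the same code are close,
    and that points with different codes of the same colour, for finitely many
    colours, are separated ([coding_map_close], [coding_map_sep]).

    Finally, alpha is the integral of an invariant measure if and only if it is
    approximated by Birkhoff averages ([integral_setE]). Given the measure,
    centred Birkhoff sums have integral 0 and vary slowly when letters are
    changed one by one. Conversely, the empirical measures of orbit pieces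
    converge along an ultrafilter to an invariant finitely additive measure on
    the clopen sets, which extends to a Borel measure by compactness
    ([clopen_content_extension]). The values approximated by Birkhoff averages
    are closed under limits and mixtures, so they form a compact interval. *)

(** * Words and codes *)

Section Words.
Context {A : finType}.
Implicit Types (w : seq A) (x : nat -> A).

Definition words n : seq (seq A) := [seq tval t | t <- enum {: n.-tuple A}].

Lemma mem_words n w : (w \in words n) = (size w == n).
Proof.
apply/mapP/idP => [[t _ ->]|/eqP sw]; first by rewrite size_tuple.
by exists (tcast sw (in_tuple w)); rewrite ?mem_enum// val_tcast.
Qed.

Lemma size_words n : size (words n) = (#|A| ^ n)%N.
Proof. by rewrite size_map -cardE card_tuple. Qed.

Definition tail k x : nat -> A := fun i => x (k + i)%N.

Lemma tail0 x : tail 0 x = x. Proof. by []. Qed.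

Lemma tailD k l x : tail k (tail l x) = tail (l + k) x.
Proof. by apply/funext => i; rewrite /tail addnA. Qed.

Definition cylinder w : set (nat -> A) := [set x | mkseq x (size w) = w].

Lemma mkseq_add x k m : mkseq x (k + m) = mkseq x k ++ mkseq (tail k x) m.
Proof.
by rewrite /mkseq iotaD add0n map_cat -[X in iota X m]addn0 iotaDl -map_comp.
Qed.

Lemma take_mkseq x k m : take k (mkseq x (k + m)) = mkseq x k.
Proof. by rewrite mkseq_add take_size_cat// size_mkseq. Qed.

Lemma drop_mkseq x k m : drop k (mkseq x (k + m)) = mkseq (tail k x) m.
Proof. by rewrite mkseq_add drop_size_cat// size_mkseq. Qed.

Lemma cylinder_mkseq x n : cylinder (mkseq x n) x.
Proof. by rewrite /cylinder/= size_mkseq. Qed.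

Lemma cylinder_cat w1 w2 x :
  cylinder (w1 ++ w2) x <-> cylinder w1 x /\ cylinder w2 (tail (size w1) x).
Proof.
rewrite /cylinder/= size_cat mkseq_add; split=> [/eqP|[-> ->]//].
by rewrite eqseq_cat ?size_mkseq// => /andP[/eqP -> /eqP ->].
Qed.

Lemma cylinder_eq w x y :
  cylinder w x -> cylinder w y -> forall i, (i < size w)%N -> x i = y i.
Proof.
move=> wx wy i iw.
by rewrite -(nth_mkseq (x i) x iw) wx -{1}wy nth_mkseq.
Qed.

Lemma eq_cylinder n x y :
  (forall i, (i < n)%N -> x i = y i) -> mkseq x n = mkseq y n.
Proof.
by move=> xy; apply/eq_in_map => i; rewrite mem_iota add0n => /xy.
Qed.

Definition prepend w x : nat -> A := fun i => nth (x (i - size w)%N) w i.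

Lemma cylinder_prepend w x : cylinder w (prepend w x).
Proof.
apply: (@eq_from_nth _ (x 0)) => [|i]; rewrite size_mkseq// => iw.
by rewrite nth_mkseq// /prepend; apply: set_nth_default.
Qed.

End Words.

Section Codes.
Context {A B : finType}.
Implicit Types (chi : A -> B) (P : set (seq A)) (w : seq A).

Definition proj_words chi P m : seq (seq B) :=
  undup [seq map chi w | w <- words m & `[< P w >]].

Definition proj_count chi P m : nat := size (proj_words chi P m).

Lemma mem_proj_words chi P m v :
  reflect (exists w, [/\ size w = m, P w & v = map chi w])
          (v \in proj_words chi P m).
Proof.
rewrite mem_undup; apply: (iffP mapP) => [[w]|[w [sw Pw ->]]].
  by rewrite mem_filter mem_words => /andP[/asboolP Pw /eqP sw] ->; exists w.
by exists w => //; rewrite mem_filter mem_words sw eqxx andbT; apply/asboolP.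
Qed.

Lemma proj_count_sub chi P P' m :
  (forall w, size w = m -> P w -> P' w) ->
  (proj_count chi P m <= proj_count chi P' m)%N.
Proof.
move=> PP'; apply: uniq_leq_size; first exact: undup_uniq.
move=> v /mem_proj_words[w [sw Pw ->]].
by apply/mem_proj_words; exists w; split=> //; exact: PP'.
Qed.

Lemma proj_count_gt0 chi P m w : size w = m -> P w -> (0 < proj_count chi P
  m)%N.
Proof.
move=> sw Pw; rewrite /proj_count lt0n size_eq0; apply/negP => /eqP E.
suff : map chi w \in proj_words chi P m by rewrite E.
by apply/mem_proj_words; exists w.
Qed.

Lemma proj_count_le chi P m : (proj_count chi P m <= #|A| ^ m)%N.
Proof.
rewrite -size_words (leq_trans (size_undup _))// size_map size_filter.
exact: count_size.
Qed.

Lemma proj_count_cat chi P1 P2 P m1 m2 :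
  (forall w1 w2, size w1 = m1 -> size w2 = m2 -> P1 w1 -> P2 w2 ->
     P (w1 ++ w2)) ->
  (proj_count chi P1 m1 * proj_count chi P2 m2
     <= proj_count chi P (m1 + m2))%N.
Proof.
move=> P12; rewrite /proj_count -(size_allpairs cat).
apply: (@uniq_leq_size _
  [seq v1 ++ v2 | v1 <- proj_words chi P1 m1, v2 <- proj_words chi P2 m2]).
  apply: allpairs_uniq => [||[u1 u2] [v1 v2]]; rewrite ?undup_uniq//.
  move=> /allpairsP[[p1 p2] /= [/mem_proj_words[w [sw _ ->]] _ [-> ->]]].
  move=> /allpairsP[[q1 q2] /= [/mem_proj_words[v [sv _ ->]] _ [-> ->]]].
  move=> /eqP; rewrite eqseq_cat ?size_map ?sw ?sv//.
  by move=> /andP[/eqP -> /eqP ->].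
move=> v /allpairsP[[p1 p2] /= [/mem_proj_words[w1 [sw1 Pw1 ->]]]].
move=> /mem_proj_words[w2 [sw2 Pw2 ->]] ->; rewrite -map_cat.
apply/mem_proj_words; exists (w1 ++ w2).
by rewrite size_cat sw1 sw2; split=> //; exact: P12.
Qed.

(** Codes describe the approximate squares of a sponge. The coordinates contract
    at different rates, so at a given scale the letters of a sequence are seen
    completely up to some position, then in all but the first coordinate up to
    another one, and so on. A strip is such a range of positions, given by its
    length, together with the projection through which its letters are seen. *)
Fixpoint code (s : seq ((A -> B) * nat)) w : seq B :=
  if s is (chi, m) :: s' then map chi (take m w) ++ code s' (drop m w)
  else [::].

Definition strips_size (s : seq ((A -> B) * nat)) : nat := sumn (unzip2 s).

Fixpoint fits (s : seq ((A -> B) * nat * set (seq A))) w : Prop :=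
  if s is (_, m, P) :: s' then P (take m w) /\ fits s' (drop m w) else True.

Definition codes (s : seq ((A -> B) * nat * set (seq A))) : seq (seq B) :=
  undup [seq code (unzip1 s) w
        | w <- words (strips_size (unzip1 s)) & `[< fits s w >]].

Lemma mem_codes s v :
  reflect (exists w, [/\ size w = strips_size (unzip1 s), fits s w
                       & v = code (unzip1 s) w])
          (v \in codes s).
Proof.
rewrite mem_undup; apply: (iffP mapP) => [[w]|[w [sw Pw ->]]].
  by rewrite mem_filter mem_words => /andP[/asboolP Pw /eqP sw] ->; exists w.
by exists w => //; rewrite mem_filter mem_words sw eqxx andbT; apply/asboolP.
Qed.

(** Concatenation is injective on words of known lengths, and the blocks can be
    chosen independently of each other. *)
Lemma size_codes s :
  size (codes s) = (\prod_(t <- s) proj_count t.1.1 t.2 t.1.2)%N.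
Proof.
elim: s => [|[[chi m] P] s IHs].
  rewrite big_nil; apply/eqP; rewrite eqn_leq; apply/andP; split.
    apply: (@leq_trans (size [:: [::] : seq B])) => //.
    apply: uniq_leq_size; first exact: undup_uniq.
    by move=> v /mem_codes[w [_ _ ->]]; rewrite inE.
  rewrite lt0n size_eq0; apply/negP => /eqP E.
  suff : [::] \in codes [::] by rewrite E.
  by apply/mem_codes; exists [::].
rewrite big_cons /= -IHs -(size_allpairs cat) -[RHS](size_map id) map_id.
apply: perm_size; apply: uniq_perm; first exact: undup_uniq.
  apply: (@allpairs_uniq _ _ _ cat) => [||[u1 u2] [v1 v2]];
    rewrite ?undup_uniq//.
  move=> /allpairsP[[p1 p2] /= [/mem_proj_words[w [sw _ ->]] _ [-> ->]]].
  move=> /allpairsP[[q1 q2] /= [/mem_proj_words[v [sv _ ->]] _ [-> ->]]].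
  move=> /eqP; rewrite eqseq_cat ?size_map ?sw ?sv//.
  by move=> /andP[/eqP -> /eqP ->].
move=> v; apply/mem_codes/allpairsP => [[w [/= sw [Pw fw] ->]]|].
  rewrite /strips_size /= in sw.
  exists (map chi (take m w), code (unzip1 s) (drop m w)); split=> //=.
    apply/mem_proj_words; exists (take m w); split=> //.
    by rewrite size_takel// sw leq_addr.
  by apply/mem_codes; exists (drop m w); rewrite size_drop sw addKn.
move=> [[p1 p2] /= [/mem_proj_words[w1 [sw1 Pw1 ->]]]].
move=> /mem_codes[w2 [sw2 fw2 ->]] ->; exists (w1 ++ w2) => /=.
rewrite size_cat /strips_size /= sw1 sw2 take_size_cat ?drop_size_cat//.
Qed.

(** Positions are given by a strip and an offset, as this is how the geometry of
    the sponge presents them. *)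
Lemma code_eq s x y :
  code s (mkseq x (strips_size s)) = code s (mkseq y (strips_size s)) <->
  forall q d, (q < size s)%N -> forall i, (i < (nth d s q).2)%N ->
    (nth d s q).1 (x (strips_size (take q s) + i)%N) =
    (nth d s q).1 (y (strips_size (take q s) + i)%N).
Proof.
elim: s x y => [|[chi m] s IHs] x y /=; first by split.
rewrite /strips_size /= -/(strips_size s) !take_mkseq !drop_mkseq; split.
  move=> /eqP; rewrite eqseq_cat ?size_map ?size_mkseq//.
  move=> /andP[/eqP E /eqP/IHs H] [|q] d /=.
    move=> _ i im; have := congr1 (fun v => nth (chi (x 0)) v i) E.
    by rewrite !(nth_map (x 0)) ?size_mkseq// !nth_mkseq.
  by move=> qs i /(H _ d qs); rewrite /tail !addnA.
move=> H; congr (_ ++ _).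
  rewrite -!map_comp; apply/eq_in_map => i; rewrite mem_iota add0n => im.
  exact: (H 0%N (chi, m)).
apply/IHs => q d qs i iq; have := H q.+1 d qs i iq.
by rewrite /= /tail !addnA.
Qed.

End Codes.

(** * Birkhoff sums and the entropy of level sets *)

Section Birkhoff.
Context {R : realType} {A : finType} (phi : (nat -> A) -> R).
Implicit Types (x y : nat -> A) (w : seq A) (alpha eps C : R).

(** Centring the Birkhoff sums at [alpha] makes them additive over consecutive
    blocks, with the same target value 0 for all block lengths. *)
Definition deviation alpha n x : R := \sum_(l < n) (phi (tail l x) - alpha).

Lemma deviation0 alpha x : deviation alpha 0 x = 0.
Proof. by rewrite /deviation big_ord0. Qed.

Lemma deviationD alpha k m x :
  deviation alpha (k + m) x = deviation alpha k x + deviation alpha m (tail k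
    x).
Proof.
rewrite /deviation big_split_ord/=; congr (_ + _).
by apply: eq_bigr => i _; rewrite tailD.
Qed.

Lemma deviation_shift alpha beta n x :
  deviation alpha n x = deviation beta n x + n%:R * (beta - alpha).
Proof.
rewrite /deviation !sumrB !sumr_const card_ord.
by rewrite -(mulr_natl alpha) -(mulr_natl beta) mulrBr addrA subrK.
Qed.

(** An elementary description of the integrals of [phi] with respect to the
    invariant measures: each approximation may use a different sequence. *)
Definition attainable alpha := forall eps, 0 < eps -> forall M, exists2 m,
  (M <= m)%N & exists x, `|deviation alpha m x| <= eps * m%:R.

(** Being near [alpha] constrains some continuation of a word at its end, which
    is the weakest useful condition; being steady constrains all continuations
    at all times, which is what concatenations need. *)
Definition near_word alpha eps : set (seq A) := [set w |
  exists2 x, cylinder w x & `|deviation alpha (size w) x| <= eps * (size w)%:R].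

Definition steady_word alpha eps C : set (seq A) := [set w |
  forall x, cylinder w x -> forall k, (k <= size w)%N ->
    `|deviation alpha k x| <= eps * k%:R + C].

Lemma steady_word_le alpha eps C C' w : C <= C' ->
  steady_word alpha eps C w -> steady_word alpha eps C' w.
Proof. by move=> CC' wC x /wC{}wC k /wC/le_trans; apply; rewrite lerD2l. Qed.

Lemma steady_word_cat alpha eps C1 C2 w1 w2 : 0 <= eps -> 0 <= C2 ->
  steady_word alpha eps C1 w1 -> steady_word alpha eps C2 w2 ->
  steady_word alpha eps (C1 + C2) (w1 ++ w2).
Proof.
move=> eps0 C20 w1C w2C x /cylinder_cat[x1 x2] k.
rewrite size_cat; have [kw _|wk kw] := leqP k (size w1).
  by apply: le_trans (w1C _ x1 _ kw) _; lra.
have [l E] : exists l, k = (size w1 + l)%N.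
  by exists (k - size w1)%N; rewrite subnKC// ltnW.
move: kw; rewrite E leq_add2l => lw; rewrite deviationD.
have := w1C _ x1 _ (leqnn _); have := w2C _ x2 _ lw.
set u := deviation _ _ _; set v := deviation _ _ _ => hu hv.
by apply: le_trans (ler_normD _ _) _; rewrite natrD; lra.
Qed.

(** The constants of the successive strips add up, while the tolerance, being
    proportional to the length, does not deteriorate. *)
Lemma steady_word_fits (B : finType) alpha eps C
    (s : seq ((A -> B) * nat * set (seq A))) w : 0 <= eps -> 0 <= C ->
  (forall t, t \in [seq t.2 | t <- s] -> t `<=` steady_word alpha eps C) ->
  size w = strips_size (unzip1 s) -> fits s w ->
  steady_word alpha eps ((size s)%:R * C) w.
Proof.
move=> eps0 C0; elim: s w => [|[[chi m] P] s IHs] w sP.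
  move=> /size0nil -> _ x _ k /=; rewrite leqn0 => /eqP ->.
  by rewrite deviation0 normr0; lra.
rewrite /strips_size /= -/(strips_size _) => sw [Pw fw].
rewrite -[w](cat_take_drop m) -natr1 mulrDl mul1r addrC.
apply: steady_word_cat => //; first by apply: mulr_ge0.
  by apply: (sP P) => //; rewrite inE eqxx.
apply: IHs => //; last by rewrite size_drop sw addKn.
by move=> t ts; apply: sP; rewrite inE ts orbT.
Qed.

End Birkhoff.

Section Entropy.
Context {R : realType} {A B : finType} (phi : (nat -> A) -> R) (chi : A -> B).
Implicit Types (x y : nat -> A) (w : seq A) (alpha eps C h : R).

Local Notation dev := (deviation phi).
Local Notation near_word := (near_word phi).
Local Notation steady_word := (steady_word phi).
Local Notation attainable := (attainable phi).

(** Exponential growth rates of the number of projected words whose Birkhoff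
    average is close to [alpha]. Their supremum is a combinatorial substitute
    for the maximal entropy of the projections of the invariant measures that
    give [phi] the integral [alpha]. *)
Definition level_rate alpha : set R := [set h |
  forall eps, 0 < eps -> forall M, exists2 m, (M <= m)%N &
    expR (h * m%:R) <= (proj_count chi (near_word alpha eps) m)%:R].

Definition level_entropy alpha : R := sup (level_rate alpha).

Lemma proj_count_expR P m : (0 < #|A|)%N ->
  (proj_count chi P m)%:R <= expR (ln #|A|%:R * m%:R) :> R.
Proof.
move=> A0; apply: (@le_trans _ _ (#|A| ^ m)%:R);
  first by rewrite ler_nat proj_count_le.
by rewrite natrX mulrC expRM_natl lnK// posrE ltr0n.
Qed.

Lemma level_rate_ub alpha h : (0 < #|A|)%N -> level_rate alpha h -> h <= ln
  #|A|%:R.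
Proof.
move=> A0 /(_ 1 ltr01 1%N)[m m0 /le_trans/(_ (proj_count_expR _ _ A0))].
by rewrite ler_expR ler_pM2r// ltr0n.
Qed.

Lemma level_rate0 alpha : attainable alpha -> level_rate alpha 0.
Proof.
move=> att eps eps0 M; have [m Mm [x xm]] := att _ eps0 M.
exists m => //; rewrite mul0r expR0 ler1n.
apply: (@proj_count_gt0 _ _ _ _ _ (mkseq x m)); rewrite ?size_mkseq//.
by exists x; rewrite ?size_mkseq//; exact: cylinder_mkseq.
Qed.

Lemma level_rate_le alpha h h' : h <= h' -> level_rate alpha h' -> level_rate
  alpha h.
Proof.
move=> hh' r' eps eps0 M; have [m Mm H] := r' _ eps0 M; exists m => //.
by apply: le_trans H; rewrite ler_expR ler_wpM2r.
Qed.

Lemma level_rate_hassup alpha : (0 < #|A|)%N -> attainable alpha ->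
  has_sup (level_rate alpha).
Proof.
move=> A0 att; split; first by exists 0; exact: level_rate0.
by exists (ln #|A|%:R) => h; exact: level_rate_ub.
Qed.

Lemma level_entropy_ge0 alpha : (0 < #|A|)%N -> attainable alpha ->
  0 <= level_entropy alpha.
Proof.
move=> A0 att; apply: ub_le_sup; last exact: level_rate0.
by have [] := level_rate_hassup A0 att.
Qed.

Lemma lt_level_entropy alpha h : (0 < #|A|)%N -> attainable alpha ->
  h < level_entropy alpha -> level_rate alpha h.
Proof.
move=> A0 att hH; have e0 : 0 < level_entropy alpha - h by rewrite subr_gt0.
have [h' rh' hh'] := sup_adherent e0 (level_rate_hassup A0 att).
by apply: level_rate_le rh'; move: hh'; rewrite -/(level_entropy _); lra.
Qed.

(** The negation of a growth rate gives this bound for long words only; the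
    constant absorbs the short ones. *)
Lemma gt_level_entropy alpha h : (0 < #|A|)%N -> attainable alpha ->
  level_entropy alpha < h -> exists2 eps : R, 0 < eps & exists C, forall m,
    (proj_count chi (near_word alpha eps) m)%:R <= expR (h * m%:R + C) :> R.
Proof.
move=> A0 att Hh.
have : ~ level_rate alpha h.
  move=> rh; suff : h <= level_entropy alpha by lra.
  by apply: ub_le_sup => //; have [] := level_rate_hassup A0 att.
move=> /existsNP[eps] /not_implyP[eps0] /existsNP[M H].
have h0 := lt_le_trans (le_lt_trans (level_entropy_ge0 A0 att) Hh) (lexx h).
have lnA : 0 <= ln #|A|%:R :> R by rewrite ln_ge0// ler1n.
exists eps => //; exists (ln #|A|%:R * M%:R) => m.
have [mM|Mm] := ltnP m M.
  apply: le_trans (proj_count_expR _ _ A0) _; rewrite ler_expR.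
  have : ln #|A|%:R * m%:R <= ln #|A|%:R * M%:R :> R.
    by rewrite ler_wpM2l// ler_nat ltnW.
  have : 0 <= h * m%:R by rewrite mulr_ge0// ltW.
  lra.
apply: (@le_trans _ _ (expR (h * m%:R))); last first.
  by rewrite ler_expR lerDl mulr_ge0.
rewrite leNgt; apply/negP => /ltW ?; apply: H; by exists m.
Qed.

End Entropy.

(** Uniform continuity for the product of the discrete topologies, expressed
    in terms of letters. *)
Definition letterwise_ucont (R : realType) (A : finType)
    (phi : (nat -> A) -> R) : Prop :=
  forall eps, 0 < eps -> exists K, forall x y,
    (forall i, (i < K)%N -> x i = y i) -> `|phi x - phi y| <= eps.

Section UniformPotential.
Context {R : realType} {A : finType} (phi : (nat -> A) -> R).
Hypothesis phi_uc : letterwise_ucont phi.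
Implicit Types (x y : nat -> A) (w : seq A) (alpha eps C h : R).

Local Notation dev := (deviation phi).
Local Notation near_word := (near_word phi).
Local Notation steady_word := (steady_word phi).
Local Notation attainable := (attainable phi).

Lemma potential_bounded alpha : exists2 E : R, 0 <= E & forall x, `|phi x -
  alpha| <= E.
Proof.
have [K HK] := phi_uc ltr01.
pose z (w : seq A) x0 := `|phi (prepend w x0) - alpha|.
have [[x0]|nx] := pselect (inhabited (nat -> A)); last first.
  by exists 0 => // x; case: nx; constructor.
exists (1 + \sum_(w <- words K) z w x0).
  by rewrite addr_ge0// sumr_ge0// => w _; exact: normr_ge0.
move=> x; rewrite -[phi x](subrK (phi (prepend (mkseq x K) x0))) -addrA.
apply: le_trans (ler_normD _ _) _; apply: lerD.
  apply: HK => i iK; apply: (@cylinder_eq _ (mkseq x K)); rewrite ?size_mkseq//.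
    exact: cylinder_mkseq.
  exact: cylinder_prepend.
have xK : mkseq x K \in words (A := A) K by rewrite mem_words size_mkseq.
by rewrite (big_rem _ xK)/= lerDl sumr_ge0// => w _; exact: normr_ge0.
Qed.

Lemma deviation_le E alpha n x : (forall x, `|phi x - alpha| <= E) ->
  `|dev alpha n x| <= n%:R * E.
Proof.
move=> HE; apply: le_trans (ler_norm_sum _ _ _) _.
apply: le_trans (ler_sum _ (fun i _ => HE _)) _.
by rewrite sumr_const card_ord mulr_natl.
Qed.

(** Birkhoff sums nearly depend on the letters summed over only: all terms but
    the last [K] see [K] common letters. *)
Lemma deviation_cylinder alpha eps : 0 < eps -> exists2 C : R, 0 <= C &
  forall n x y, (forall i, (i < n)%N -> x i = y i) ->
    `|dev alpha n x - dev alpha n y| <= eps * n%:R + C.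
Proof.
move=> eps0; have [K HK] := phi_uc eps0.
have [E E0 HE] := potential_bounded alpha.
exists (K%:R * (2 * E)); first by rewrite mulr_ge0// mulr_ge0.
have crude m x y : `|dev alpha m x - dev alpha m y| <= m%:R * (2 * E).
  have := deviation_le m x HE; have := deviation_le m y HE.
  set u := dev _ _ _; set v := dev _ _ _ => hu hv.
  by apply: le_trans (ler_normB _ _) _; lra.
move=> n x y xy; have [nK|Kn] := leqP n K.
  apply: le_trans (crude _ _ _) _.
  have : n%:R * (2 * E) <= K%:R * (2 * E).
    by apply: ler_wpM2r; [exact: mulr_ge0 | rewrite ler_nat].
  have : 0 <= eps * n%:R by rewrite mulr_ge0// ltW.
  lra.
have [m Em] : exists m, n = (m + K)%N by exists (n - K)%N; rewrite subnK// ltnW.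
rewrite Em !deviationD opprD addrACA; apply: le_trans (ler_normD _ _) _.
apply: lerD; last exact: crude.
rewrite -sumrB; apply: le_trans (ler_norm_sum _ _ _) _.
apply: (@le_trans _ _ (\sum_(l < m) eps)).
  apply: ler_sum => l _; rewrite opprB addrA subrK; apply: HK => i iK.
  by apply: xy; rewrite Em -addnS leq_add// ltnW.
by rewrite sumr_const card_ord -[eps *+ m]mulr_natr ler_wpM2l ?(ltW eps0)//
  ler_nat leq_addr.
Qed.

(** Concatenating blocks of one fixed length [m0] keeps the deviation under
    control at all times, not just at the end, and costs only a bounded factor
    in the number of words. *)
Lemma steady_count (B : finType) (chi : A -> B) alpha h eps :
  level_rate phi chi alpha h -> 0 < eps -> exists2 C : R, 0 <= C &
  forall m, expR (h * m%:R - C)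
              <= (proj_count chi (steady_word alpha eps C) m)%:R.
Proof.
(* One third of [eps] is for the definition of [near_word], one for the
   variation inside a cylinder, one for its constant [C0] when [m0] is large. *)
move=> rh eps0; have eps30 : 0 < eps / 3 by lra.
have [C0 C00 HC0] := deviation_cylinder alpha eps30.
have [E E0 HE] := potential_bounded alpha.
have [M HM] : exists M, C0 <= eps / 3 * M%:R.
  exists (Num.truncn (C0 / (eps / 3))).+1.
  by rewrite mulrC -ler_pdivrMr// ltW// truncnS_gt.
have [m0 Mm0 Hm0] := rh _ eps30 M.+1.
have m00 : (0 < m0)%N by exact: leq_trans Mm0.
have good w x : size w = m0 -> near_word alpha (eps / 3) w -> cylinder w x ->
    `|dev alpha m0 x| <= eps * m0%:R.
  move=> sw [y wy]; rewrite sw => Hy wx.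
  have xy i : (i < m0)%N -> x i = y i.
    by rewrite -sw; exact: (cylinder_eq wx wy).
  have := HC0 m0 x y xy.
  have : eps / 3 * M%:R <= eps / 3 * m0%:R.
    by rewrite ler_wpM2l ?(ltW eps30)// ler_nat ltnW.
  have := ler_normD (dev alpha m0 x - dev alpha m0 y) (dev alpha m0 y).
  by rewrite subrK; lra.
pose D := m0%:R * E; have D0 : 0 <= D by exact: mulr_ge0.
(* Fewer than [m0] letters, such as a final incomplete block, are covered by
   the constant alone. *)
have short w : (size w < m0)%N -> steady_word alpha eps D w.
  move=> wm x _ k kw; apply: le_trans (deviation_le k x HE) _.
  rewrite -[leLHS]add0r lerD ?mulr_ge0 ?(ltW eps0)//.
  by rewrite ler_wpM2r// ler_nat (leq_trans kw)// ltnW.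
have step w1 w2 : size w1 = m0 -> near_word alpha (eps / 3) w1 ->
    steady_word alpha eps D w2 -> steady_word alpha eps D (w1 ++ w2).
  move=> s1 n1 n2 x /cylinder_cat[x1 x2] k; rewrite size_cat s1.
  have [km _|mk] := ltnP k m0.
    apply: le_trans (deviation_le k x HE) _.
    rewrite -[leLHS]add0r lerD ?mulr_ge0 ?(ltW eps0)//.
    by rewrite ler_wpM2r// ler_nat ltnW.
  rewrite -(subnKC mk) leq_add2l => lw; rewrite deviationD.
  move: x2; rewrite s1 => x2; have := good _ _ s1 n1 x1.
  have := n2 _ x2 _ lw; set u := dev _ _ _; set v := dev _ _ _ => hu hv.
  by apply: le_trans (ler_normD _ _) _; rewrite natrD; lra.
have blocks k r : (r < m0)%N ->
    expR (h * m0%:R) ^+ k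
      <= (proj_count chi (steady_word alpha eps D) (k * m0 + r))%:R :> R.
  move=> rm; elim: k => [|k IHk].
    have [[w sw]|nw] := pselect (exists w : seq A, size w = r).
      rewrite expr0 ler1n; apply: (@proj_count_gt0 _ _ _ _ _ w) => //.
      by apply: short; rewrite sw.
    have : (0 < proj_count chi (near_word alpha (eps / 3)) m0)%N.
      by rewrite -(ltr_nat R); apply: lt_le_trans (expR_gt0 _) Hm0.
    rewrite /proj_count; case E1 : (proj_words _ _ _) => [//|v s] _.
    have /mem_proj_words[w [sw _ _]] : v \in proj_words chi (near_word alpha
      (eps / 3)) m0.
      by rewrite E1 inE eqxx.
    by exfalso; apply: nw; exists (take r w); rewrite size_takel// sw ltnW.
  rewrite exprS mulSn -addnA.
  have H := @proj_count_cat _ _ chi _ _ _ m0 (k * m0 + r)%N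
    (fun w1 w2 s1 s2 => @step w1 w2 s1).
  apply: le_trans (_ : _ <= (_ * _)%:R) _; last by rewrite ler_nat; exact: H.
  by rewrite natrM; apply: ler_pM => //; rewrite ?exprn_ge0 ?expR_ge0.
pose C := Num.max D (`|h| * m0%:R).
have DC : D <= C by rewrite le_max lexx.
have hC : `|h| * m0%:R <= C by rewrite le_max lexx orbT.
exists C; first exact: le_trans DC.
move=> m; apply: le_trans (_ : _ <= expR (h * m0%:R) ^+ (m %/ m0)) _;
  last first.
  apply: le_trans (blocks (m %/ m0)%N (m %% m0)%N _) _;
    first by rewrite ltn_mod.
  rewrite -divn_eq ler_nat; apply: proj_count_sub => w _.
  exact: steady_word_le.
rewrite -expRM_natl ler_expR {1}(divn_eq m m0) natrD natrM.
have : h * (m %% m0)%:R <= `|h| * m0%:R.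
  apply: le_trans (ler_norm _) _; rewrite normrM normr_nat.
  by rewrite ler_wpM2l// ler_nat ltnW// ltn_mod.
lra.
Qed.

End UniformPotential.

(** * Codes and the packing dimension *)

(** Exponential bound on the number of codes seen at level [n]. When level [n]
    corresponds to the scale [expR (- n)], this is the symbolic counterpart of
    an upper box dimension at most [t]. *)
Definition code_growth_le (R : realType) (X : Type) (V : eqType)
    (cd : nat -> X -> V) (t : R) (F : set X) : Prop :=
  exists C n0, forall n, (n0 <= n)%N -> forall vs : seq V, uniq vs ->
    (forall v, v \in vs -> exists2 x, F x & v = cd n x) ->
    (size vs)%:R <= expR (t * n%:R + C).

Lemma natr_large (R : realType) (c K : R) : 0 < c ->
  exists M, forall m, (M <= m)%N -> K <= c * m%:R.
Proof.
move=> c0; exists (Num.truncn (K / c)).+1 => m Mm.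
rewrite mulrC -ler_pdivrMr// ltW// (lt_le_trans (truncnS_gt _))// ler_nat.
exact: Mm.
Qed.

Section PackingCodes.
Context {R : realType} {T : metricType R} {X : Type} {V : eqType}.
Variables (P : X -> T) (cd : nat -> X -> V) (x0 : X).
Implicit Types (F J : set X) (E : set T) (s t : R).

Lemma packing_premeasure_delta_ge0 s delta E :
  (0 <= packing_premeasure_delta s delta E)%E.
Proof.
apply: ereal_sup_ubound; exists set0, (fun=> P x0), (fun=> 1).
split; last by rewrite /packing_sum esum_set0.
by split=> // i j [].
Qed.

Lemma packing_premeasure_ge0 s E : (0 <= packing_premeasure s E)%E.
Proof.
by apply: le_ereal_inf_tmp => _ [delta _ <-];
  exact: packing_premeasure_delta_ge0.
Qed.

Lemma packing_measure_ge0 s E : (0 <= packing_measure s E)%E.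
Proof.
apply: le_ereal_inf_tmp => _ [F _ <-].
by apply: nneseries_ge0 => i _ _; exact: packing_premeasure_ge0.
Qed.

Lemma geometric_tail_le (q : R) m n : 0 <= q -> q < 1 ->
  \sum_(m <= k < n) q ^+ k <= q ^+ m / (1 - q).
Proof.
move=> q0 q1; have q10 : 0 < 1 - q by rewrite subr_gt0.
rewrite ler_pdivlMr// mulr_suml.
have [nm|mn] := leqP n m; first by rewrite big_geq// exprn_ge0.
have -> : \sum_(m <= k < n) q ^+ k * (1 - q) = \sum_(m <= k < n) (q ^+ k - q
  ^+ k.+1).
  by apply: eq_bigr => k _; rewrite mulrBr mulr1 exprSr.
under eq_bigr do rewrite -opprB.
by rewrite sumrN telescope_sumr ?(ltnW mn)// opprB lerBlDr lerDl exprn_ge0.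
Qed.

Section Upper.
Variable kappa : R.
Hypothesis kappa_gt0 : 0 < kappa.
Hypothesis code_close : forall n x y, cd n x = cd n y ->
  mdist (P x) (P y) <= kappa * expR (- n%:R).

(** The level of a radius [r] is a scale comparable with it, chosen so that a
    ball of radius [r] contains all points with the code of its centre. *)
Let level (r : R) : nat := (Num.truncn (ln (kappa / r)) + 1)%N.

Let level_le r : 0 < r -> kappa * expR (- (level r)%:R) <= r.
Proof.
move=> r0; rewrite -ler_pdivlMl// mulrC -ler_ln ?posrE ?expR_gt0 ?divr_gt0//.
rewrite expRK -(invf_div kappa) lnV ?posrE ?divr_gt0// lerN2 ltW//.
by rewrite /level addn1 truncnS_gt.
Qed.

Let le_level r : 0 < r <= kappa -> r <= kappa * expR (1 - (level r)%:R).
Proof.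
move=> /andP[r0 rk]; rewrite -ler_pdivrMl// mulrC.
rewrite -ler_ln ?posrE ?expR_gt0 ?divr_gt0// expRK -(invf_div kappa).
rewrite lnV ?posrE ?divr_gt0// /level natrD.
suff : (Num.truncn (ln (kappa / r)))%:R <= ln (kappa / r) by lra.
by rewrite truncn_le ln_ge0// ler_pdivlMr ?mul1r.
Qed.

Let level_ge r N : 0 < r -> r <= kappa * expR (- N%:R) -> (N <= level r)%N.
Proof.
move=> r0 rN; rewrite /level addn1 leqW// truncn_ge_nat; last first.
  rewrite ln_ge0// ler_pdivlMr// mul1r (le_trans rN)// ler_piMr//.
  exact: ltW.
rewrite -[N%:R]expRK ler_ln ?posrE ?expR_gt0 ?divr_gt0// ler_pdivlMr//.
by rewrite mulrC -ler_pdivlMr ?expR_gt0// -expRN.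
Qed.

(** The balls of a packing with level [n] have centres with distinct codes at
    level [n], since each ball contains all points with the code of its centre.
    So the number of balls of level [n] is of the order [expR (t * n)] at most,
    and the [s]-th powers of all diameters are bounded by a geometric tail. *)
Lemma packing_premeasure_eq0 s t F : 0 <= s -> t < s -> code_growth_le cd t F ->
  packing_premeasure s (P @` F) = 0%E.
Proof.
move=> s0 ts [C [n0 HF]]; apply/eqP.
rewrite eq_le packing_premeasure_ge0 andbT; apply/lee_addgt0Pr => e e0.
rewrite add0e; have st0 : 0 < s - t by rewrite subr_gt0.
pose q := expR (- (s - t)).
have q0 : 0 < q by exact: expR_gt0.
have q1 : q < 1 by rewrite /q -expR0 ltr_expR oppr_lt0.
have powq k : q ^+ k = expR (- (s - t) * k%:R) by rewrite mulrC expRM_natl.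
(* A diameter of level [n] is at most [2 * (kappa * expR 1) * expR (- n)]. *)
pose K := (2 * (kappa * expR 1)) `^ s * expR C.
have K0 : 0 < K by rewrite mulr_gt0 ?expR_gt0// powR_gt0// mulr_gt0 ?mulr_gt0
  ?expR_gt0.
have [N0 HN0] := natr_large (ln (K / (1 - q) / e)) st0.
pose N := (n0 + N0)%N.
have HN : K * (q ^+ N / (1 - q)) <= e.
  have q10 : 0 < 1 - q by rewrite subr_gt0.
  have := HN0 N (leq_addl _ _).
  rewrite -[X in _ <= X]expRK ler_ln ?posrE ?divr_gt0 ?expR_gt0//.
  rewrite ler_pdivrMr// powq mulNr expRN.
  set E := expR _; have E0 : 0 < E by exact: expR_gt0.
  by rewrite mulrCA ler_pdivrMl// mulrA.
apply: le_trans (ereal_inf_lbound _) _.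
  by exists (Num.min kappa (kappa * expR (- N%:R)));
    rewrite /= ?lt_min ?kappa_gt0 ?mulr_gt0 ?expR_gt0.
apply: ge_ereal_sup => _ [I [c [r [[Icr disj] ->]]]].
apply: ge_ereal_sup => _ [Y [finY YI]] <-.
rewrite fsbig_finite// sumEFin lee_fin.
pose Ys : seq nat := fset_set Y; rewrite -/Ys.
have uYs : uniq Ys by exact: fset_uniq.
have YI' i : i \in Ys -> I i.
  by move=> iY; apply: YI; apply: set_mem; rewrite -in_fset_set.
have rI i : I i -> 0 < r i <= kappa /\ r i <= kappa * expR (- N%:R).
  move=> /Icr[_ /andP[r0]]; rewrite le_min => /andP[rk rN].
  by rewrite r0 rk.
have /choice[x Hx] i : exists x, I i -> F x /\ P x = c i.
  have [/Icr[[x Fx <-] _]|nI] := pselect (I i); first by exists x.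
  by exists x0.
have size_level n : (n0 <= n)%N ->
    (count (fun i => level (r i) == n) (Ys))%:R <= expR (t * n%:R + C).
  move=> n0n; rewrite -size_filter -(size_map (fun i => cd n (x i))).
  apply: HF => //; last first.
    move=> v /mapP[i]; rewrite mem_filter => /andP[_ /YI' Ii] ->.
    by exists (x i) => //; have [] := Hx i Ii.
  rewrite map_inj_in_uniq ?filter_uniq// => i j.
  rewrite !mem_filter => /andP[/eqP ni /YI' Ii] /andP[/eqP nj /YI' Ij] cij.
  apply: disj => //; exists (c j); split; rewrite /mclosed_ball /=; last first.
    by rewrite mdistxx; have [/andP[/ltW]] := rI j Ij.
  have [_ <-] := Hx i Ii; have [_ <-] := Hx j Ij.
  apply: le_trans (code_close cij) _; rewrite -ni; apply: level_le.
  by have [/andP[]] := rI i Ii.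
pose M := (\max_(i <- Ys) level (r i)).+1.
have Mlevel i : i \in Ys -> (N <= level (r i) < M)%N.
  move=> iY; have [/andP[r0 _] rN] := rI i (YI' _ iY).
  by rewrite level_ge//= ltnS (leq_bigmax_seq i).
have K's0 : 0 <= (2 * (kappa * expR 1)) `^ s by exact: powR_ge0.
apply: le_trans (_ : _ <= \sum_(i <- Ys)
    (2 * (kappa * expR 1)) `^ s * expR (- s * (level (r i))%:R)) _.
  rewrite big_seq [leRHS]big_seq; apply: ler_sum => i iY.
  have [/andP[r0 rk] _] := rI i (YI' _ iY).
  have -> : expR (- s * (level (r i))%:R) = expR (- (level (r i))%:R) `^ s.
    by rewrite -expRM; congr expR; ring.
  rewrite -powRM ?expR_ge0//; last first.
    by rewrite mulr_ge0 ?expR_ge0// mulr_ge0// ?expR_ge0// ltW.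
  rewrite ge0_ler_powR// ?nnegrE ?mulr_ge0 ?expR_ge0 ?(ltW r0) ?(ltW
    kappa_gt0)//.
  by rewrite -!mulrA -expRD ler_pM2l// le_level// r0.
apply: le_trans HN.
have -> : \sum_(i <- Ys) (2 * (kappa * expR 1)) `^ s * expR (- s * (level (r
  i))%:R)
  = \sum_(N <= n < M) \sum_(i <- Ys | level (r i) == n)
      (2 * (kappa * expR 1)) `^ s * expR (- s * n%:R).
  rewrite (exchange_big_dep xpredT)//=; apply: eq_big_seq => i iY.
  rewrite -big_filter (_ : [seq _ <- _ | _] = [:: level (r i)]) ?big_seq1//.
  apply/perm_small_eq => //; apply: uniq_perm => //.
    by rewrite filter_uniq// iota_uniq.
  move=> n; rewrite mem_filter mem_index_iota inE eq_sym.
  by apply: andb_idr => /eqP <-; exact: Mlevel.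
apply: le_trans (_ : _ <= \sum_(N <= n < M) K * q ^+ n) _; last first.
  rewrite -mulr_sumr ler_wpM2l ?(ltW K0)//.
  by apply: geometric_tail_le => //; exact: ltW.
rewrite big_nat [leRHS]big_nat; apply: ler_sum => n /andP[Nn _].
rewrite big_const_seq iter_addr_0 -[_ *+ _]mulr_natr powq -mulrA /K -mulrA.
apply: ler_wpM2l => //.
apply: le_trans (_ : _ <= expR (- s * n%:R) * expR (t * n%:R + C)) _.
  rewrite ler_wpM2l ?expR_ge0// size_level// (leq_trans _ Nn)// /N leq_addr.
  by [].
rewrite -!expRD ler_expR; lra.
Qed.

End Upper.

Section Lower.
Context {G : finType} (col : nat -> X -> G) (u : R).
Hypothesis u_gt0 : 0 < u.
Hypothesis code_sep : forall n x y, col n x = col n y -> cd n x <> cd n y ->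
  u * expR (- n%:R) <= mdist (P x) (P y).

(** One point for each code of a most frequent colour: these points are
    separated, so they are the centres of a packing by balls of equal radii,
    and its size bounds the number of codes up to the number of colours. *)
Lemma code_growth_preimage s E : 0 <= s -> (packing_premeasure s E < 1)%E ->
  code_growth_le cd s (P @^-1` E).
Proof.
move=> s0 /ereal_inf_lt[_ [delta /= delta0 <-]] Hdelta.
have [n0 Hn0] := natr_large (ln (u / 3 / delta)) ltr01.
pose b := 2 * (u / 3).
have b0 : 0 < b by rewrite mulr_gt0// divr_gt0.
exists (ln #|G|%:R - s * ln b), n0 => n n0n vs uvs vsE.
pose rho := u / 3 * expR (- n%:R).
have rho0 : 0 < rho by rewrite mulr_gt0 ?expR_gt0// divr_gt0.
have rho_delta : rho <= delta.
  have := Hn0 n n0n; rewrite mul1r -[X in _ <= X]expRK.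
  rewrite ler_ln ?posrE ?expR_gt0 ?divr_gt0//.
  by rewrite ler_pdivrMr// => H;
    rewrite /rho expRN ler_pdivrMr ?expR_gt0// [_ * expR _]mulrC.
have two_rho : 2 * rho = b * expR (- n%:R) by rewrite /rho /b mulrA.
have /choice[x Hx] v : exists x, v \in vs -> E (P x) /\ cd n x = v.
  have [vvs|] := boolP (v \in vs); last by exists x0.
  by have [x Ex ->] := vsE v vvs; exists x.
have one_colour g :
    (count (fun v => col n (x v) == g) vs)%:R <= expR (s * n%:R - s * ln b).
  rewrite -size_filter; set ws := [seq _ <- vs | _].
  have wsP w : w \in ws -> w \in vs /\ col n (x w) = g.
    by rewrite mem_filter => /andP[/eqP].
  pose c i := P (x (nth (cd n x0) ws i)).
  have wsi i : (i < size ws)%N -> nth (cd n x0) ws i \in ws by exact: mem_nth.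
  have pack : is_packing E delta `I_(size ws) c (fun=> rho).
    split=> [i /= iws|i j /= iws jws [z []]].
      rewrite rho0 rho_delta; split=> //.
      by have [/Hx[]] := wsP _ (wsi i iws).
    rewrite /mclosed_ball /= => iz jz; apply/eqP; apply: contraT => ij.
    have [vi ci] := wsP _ (wsi i iws); have [vj cj] := wsP _ (wsi j jws).
    have : u * expR (- n%:R) <= mdist (c i) (c j).
      apply: code_sep; first by rewrite ci cj.
      have [_ ->] := Hx _ vi; have [_ ->] := Hx _ vj.
      by apply/eqP; rewrite nth_uniq// filter_uniq.
    have := metric_triangle (c i) z (c j); rewrite [mdist z _]metric_sym.
    have : u * expR (- n%:R) = 3 * rho by rewrite /rho; field.
    lra.
  have sum_lt1 : (packing_sum s `I_(size ws) (fun=> rho) < 1)%E.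
    apply: le_lt_trans Hdelta; apply: ereal_sup_ubound.
    by exists `I_(size ws), c, (fun=> rho).
  have : (((size ws)%:R * (2 * rho) `^ s)%:E <= packing_sum s `I_(size ws)
    (fun=> rho))%E.
    apply: esum_ge; exists `I_(size ws); first by split=> //; exact: finite_II.
    rewrite -fsbig_ord sumEFin lee_fin sumr_const card_ord.
    by rewrite mulr_natl.
  move=> /le_lt_trans/(_ sum_lt1); rewrite lte_fin => lt1.
  have rs0 : 0 < (2 * rho) `^ s by apply: powR_gt0; rewrite mulr_gt0.
  move: lt1; rewrite -ltr_pdivlMr// mul1r => /ltW/le_trans; apply.
  rewrite two_rho powRM ?expR_ge0 ?(ltW b0)// -[X in _ <= X]invrK -expRN.
  rewrite lef_pV2 ?posrE ?mulr_gt0 ?powR_gt0 ?expR_gt0//.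
  by rewrite -expRM /powR gt_eqF// -expRD ler_expR; lra.
have sum_colours (l : seq V) :
    size l = (\sum_(g : G) count (fun v => col n (x v) == g) l)%N.
  elim: l => [|v l IHl] /=; first by rewrite big1.
  rewrite big_split/= -IHl (bigD1 (col n (x v)))//= eqxx big1// => g.
  by rewrite eq_sym => /negPf ->.
rewrite sum_colours natr_sum.
apply: le_trans (ler_sum _ (fun g _ => one_colour g)) _.
have G0 : (0 < #|G|)%N by apply/card_gt0P; exists (col n x0).
have lnG : expR (ln #|G|%:R) = #|G|%:R :> R by rewrite lnK// posrE ltr0n.
by rewrite sumr_const -[_ *+ _]mulr_natl -{1}lnG -expRD ler_expR; lra.
Qed.

End Lower.

(** A bound on the growth of codes makes the premeasures with larger exponents
    vanish, and a small premeasure bounds the growth with the same exponent. So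
    covers by sets of small premeasure and covers by sets of bounded growth have
    the same critical exponent. *)
Lemma packing_dim_codes (kappa : R) (G : finType) (col : nat -> X -> G) (u :
  R) J D :
  0 < kappa -> 0 < u ->
  (forall n x y, cd n x = cd n y -> mdist (P x) (P y) <= kappa * expR (-
    n%:R)) ->
  (forall n x y, col n x = col n y -> cd n x <> cd n y ->
     u * expR (- n%:R) <= mdist (P x) (P y)) ->
  0 <= D ->
  (forall t, D < t -> exists F : nat -> set X,
     J `<=` \bigcup_i F i /\ forall i, code_growth_le cd t (F i)) ->
  (forall t (F : nat -> set X), t < D -> (forall i, code_growth_le cd t (F i))
    ->
     exists2 x, J x & forall i, ~ F i x) ->
  packing_dim (P @` J) = D%:E.
Proof.
move=> kappa0 u0 close sep D0 upper lower; apply/eqP; rewrite eq_le;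
  apply/andP; split.
  apply/lee_addgt0Pr => e e0; rewrite -EFinD.
  apply: ereal_inf_lbound; exists (D + e) => //; split;
    first by rewrite addr_ge0// ltW.
  have [F [JF HF]] := upper (D + e / 2) ltac:(by rewrite ltrDl divr_gt0).
  apply/eqP; rewrite eq_le packing_measure_ge0 andbT.
  apply: ereal_inf_lbound; exists (fun i => P @` F i).
    by rewrite /= -image_bigcup; exact: image_subset.
  apply: eseries0 => i _ _.
  apply: (packing_premeasure_eq0 kappa0 close (t := D + e / 2)) => //.
    by rewrite addr_ge0// ltW.
  lra.
apply: le_ereal_inf_tmp => _ [s [s0 Hs] <-]; rewrite lee_fin leNgt;
  apply/negP => sD.
have [_ [E /= JE <-] HE] : exists2 y, [set (\sum_(0 <= i <oo)
  packing_premeasure s (F i))%E |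
             F in [set F : nat -> set T | P @` J `<=` \bigcup_i F i]] y & (y <
               1)%E.
  by apply: ereal_inf_lt; rewrite -/(packing_measure s (P @` J)) Hs lte01.
have [|x Jx nx] := lower s (fun i => P @^-1` E i) sD.
  move=> i; apply: (code_growth_preimage u0 sep) => //.
  apply: le_lt_trans HE; apply: le_trans (nneseries_lim_ge i.+1 _) => //.
    rewrite big_nat_recr//= leeDr// sume_ge0// => j _.
    exact: packing_premeasure_ge0.
  by move=> j _ _; exact: packing_premeasure_ge0.
by have [i _ Ei] := JE (P x) (ex_intro2 _ _ x Jx erefl); exact: (nx i).
Qed.

End PackingCodes.

(** * Concavity and semicontinuity of the entropy *)

Section EntropyRegularity.
Context {R : realType} {A B : finType} (phi : (nat -> A) -> R) (chi : A -> B).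
Hypothesis phi_uc : letterwise_ucont phi.
Hypothesis A0 : (0 < #|A|)%N.
Implicit Types (x y : nat -> A) (w : seq A) (alpha beta eps C h : R).

Local Notation dev := (deviation phi).
Local Notation attainable := (attainable phi).

Lemma level_rate_attainable alpha h : level_rate phi chi alpha h -> attainable
  alpha.
Proof.
move=> rh eps eps0 M; have [m Mm H] := rh _ eps0 M; exists m => //.
have : (0 < proj_count chi (near_word phi alpha eps) m)%N.
  by rewrite -(ltr_nat R); apply: lt_le_trans (expR_gt0 _) H.
rewrite /proj_count; case E1 : (proj_words _ _ _) => [//|v s] _.
have /mem_proj_words[w [sw [x _ Hx] _]] :
  v \in proj_words chi (near_word phi alpha eps) m by rewrite E1 inE eqxx.
by exists x; rewrite -sw.
Qed.

(** Words for [alpha1] followed by words for [alpha2], in the proportion of [t]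
    to [1 - t], are words for the barycentre, and both can be chosen freely. *)
Lemma level_rate_mix t alpha1 alpha2 h1 h2 eta : 0 <= t <= 1 -> 0 < eta ->
  level_rate phi chi alpha1 h1 -> level_rate phi chi alpha2 h2 ->
  level_rate phi chi (t * alpha1 + (1 - t) * alpha2) (t * h1 + (1 - t) * h2 -
    eta).
Proof.
move=> /andP[t0 t1] eta0 r1 r2 eps eps0 M; have e20 : 0 < eps / 2 by lra.
have [C1 C10 H1] := steady_count phi_uc r1 e20.
have [C2 C20 H2] := steady_count phi_uc r2 e20.
have [M1 HM1] := natr_large (C1 + C2 + `|alpha1 - alpha2|) e20.
have [M2 HM2] := natr_large (C1 + C2 + `|h1 - h2|) eta0.
exists (M + (M1 + M2))%N; first exact: leq_addr.
set m := (M + _)%N.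
have {}HM1 := HM1 m ltac:(by rewrite /m addnCA leq_addr).
have {}HM2 := HM2 m ltac:(by rewrite /m !addnA leq_addl).
pose m1 := Num.truncn (t * m%:R).
have tm0 : 0 <= t * m%:R by exact: mulr_ge0.
have m1t : m1%:R <= t * m%:R by rewrite truncn_le.
have tm1 : t * m%:R < m1%:R + 1 by have := truncnS_gt (t * m%:R);
  rewrite -natr1.
have m1m : (m1 <= m)%N.
  by rewrite -(ler_nat R); apply: le_trans m1t _; rewrite ler_piMl.
have [m2 Em] : exists m2, m = (m1 + m2)%N by exists (m - m1)%N; rewrite subnKC.
have Em' : m%:R = m1%:R + m2%:R :> R by rewrite Em natrD.
have d01 : `|m1%:R - t * m%:R| <= 1 by rewrite ler_norml; lra.
have split_le u v : `|m1%:R * u + m2%:R * v - m%:R * (t * u + (1 - t) * v)| <=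
  `|u - v|.
  have -> : m1%:R * u + m2%:R * v - m%:R * (t * u + (1 - t) * v)
            = (m1%:R - t * m%:R) * (u - v) by rewrite Em'; ring.
  by rewrite normrM ler_piMl.
rewrite Em; apply: le_trans (_ : _ <= (_ * _)%:R) _; last first.
  rewrite ler_nat; apply: (@proj_count_cat _ _ chi
    (steady_word phi alpha1 (eps / 2) C1) (steady_word phi alpha2 (eps / 2)
      C2)).
  move=> w1 w2 s1 s2 st1 st2.
  have [a _] := card_gt0P A0.
  exists (prepend (w1 ++ w2) (fun=> a)); first exact: cylinder_prepend.
  set x := prepend _ _.
  have /cylinder_cat[x1 x2] : cylinder (w1 ++ w2) x by exact: cylinder_prepend.
  rewrite size_cat s1 s2 deviationD.
  rewrite (deviation_shift phi _ alpha1 m1) (deviation_shift phi _ alpha2 m2).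
  have /= := st1 _ x1 m1; rewrite s1 leqnn => /(_ isT).
  have /= := st2 _ x2 m2; rewrite s1 s2 leqnn => /(_ isT).
  have := split_le alpha1 alpha2; rewrite -Em Em'; rewrite Em' in HM1.
  set p := dev _ _ _; set q := dev _ _ _ => hs hp hq.
  move: hs; set b := t * _ + _ => hs.
  have -> : q + m1%:R * (alpha1 - b) + (p + m2%:R * (alpha2 - b)) =
     q + p + (m1%:R * alpha1 + m2%:R * alpha2 - (m1%:R + m2%:R) * b) by ring.
  apply: le_trans (ler_normD _ _) _.
  have := ler_normD q p; lra.
rewrite natrM; apply: le_trans (_ : _ <= expR (h1 * m1%:R - C1) * expR (h2 *
  m2%:R - C2)) _; last first.
  by apply: ler_pM; rewrite ?expR_ge0.
rewrite -expRD ler_expR -Em.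
have := split_le h1 h2; rewrite ler_norml => /andP[+ _].
have -> : (t * h1 + (1 - t) * h2 - eta) * m%:R
  = m%:R * (t * h1 + (1 - t) * h2) - eta * m%:R by ring.
lra.
Qed.

Lemma level_entropy_concave t alpha1 alpha2 : 0 <= t <= 1 ->
  attainable alpha1 -> attainable alpha2 ->
  attainable (t * alpha1 + (1 - t) * alpha2) ->
  t * level_entropy phi chi alpha1 + (1 - t) * level_entropy phi chi alpha2
    <= level_entropy phi chi (t * alpha1 + (1 - t) * alpha2).
Proof.
move=> t01 at1 at2 at12; apply/ler_addgt0Pr => e e0;
  have e20 : 0 < e / 2 by lra.
have r1 : level_rate phi chi alpha1 (level_entropy phi chi alpha1 - e / 2).
  by apply: lt_level_entropy => //; rewrite ltrBlDr ltrDl.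
have r2 : level_rate phi chi alpha2 (level_entropy phi chi alpha2 - e / 2).
  by apply: lt_level_entropy => //; rewrite ltrBlDr ltrDl.
have := level_rate_mix t01 e20 r1 r2; set h := (X in level_rate _ _ _ X) => rh.
have : h <= level_entropy phi chi (t * alpha1 + (1 - t) * alpha2).
  by apply: ub_le_sup => //; have [] := level_rate_hassup chi A0 at12.
rewrite /h; lra.
Qed.

(** The tolerance in the definition of the entropy leaves room for moving the
    value of the Birkhoff averages. *)
Lemma level_entropy_usc alpha h : attainable alpha ->
  level_entropy phi chi alpha < h -> exists2 d : R, 0 < d & forall beta,
    attainable beta -> `|beta - alpha| <= d -> level_entropy phi chi beta <= h.
Proof.
move=> att Hh; have [eps eps0 [C HC]] := gt_level_entropy A0 att Hh.
have e20 : 0 < eps / 2 by lra.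
exists (eps / 2) => // beta attb ab; rewrite leNgt; apply/negP => hH.
pose h' := (h + level_entropy phi chi beta) / 2.
have rh' : level_rate phi chi beta h'.
  by apply: lt_level_entropy => //; rewrite /h'; lra.
have hh' : 0 < h' - h by rewrite /h'; lra.
have [M HM] := natr_large (C + 1) hh'.
have [m Mm Hm] := rh' _ e20 M; have {}HM := HM m Mm.
have : expR (h' * m%:R) <= expR (h * m%:R + C).
  apply: le_trans Hm _; apply: le_trans _ (HC m).
  rewrite ler_nat; apply: proj_count_sub => w sw [x wx Hx]; exists x => //.
  rewrite (deviation_shift phi alpha beta).
  apply: le_trans (ler_normD _ _) _; rewrite normrM normr_nat.
  have : (size w)%:R * `|beta - alpha| <= (size w)%:R * (eps / 2) by rewrite
    ler_wpM2l.
  lra.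
rewrite ler_expR; lra.
Qed.

End EntropyRegularity.

Section Attainable.
Context {R : realType} {A : finType} (phi : (nat -> A) -> R).
Hypothesis phi_uc : letterwise_ucont phi.
Hypothesis A0 : (0 < #|A|)%N.
Implicit Types (x y : nat -> A) (alpha beta eps : R).

Local Notation dev := (deviation phi).
Local Notation attainable := (attainable phi).

Lemma attainable_const a : attainable (phi (fun=> a)).
Proof.
move=> eps eps0 M; exists M => //; exists (fun=> a).
rewrite /deviation big1 ?normr0 ?mulr_ge0 ?(ltW eps0)// => l _.
by rewrite (_ : tail l _ = (fun=> a)) ?subrr.
Qed.

(** Mixing words does not refer to a projection, so the identity serves. *)
Lemma attainable_mix t alpha1 alpha2 : 0 <= t <= 1 ->
  attainable alpha1 -> attainable alpha2 ->
  attainable (t * alpha1 + (1 - t) * alpha2).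
Proof.
move=> t01 at1 at2; have := level_rate_mix phi_uc A0 t01 ltr01
  (level_rate0 (@id A) at1) (level_rate0 (@id A) at2).
exact: level_rate_attainable.
Qed.

Lemma attainable_closed alpha :
  (forall d, 0 < d -> exists2 beta, `|beta - alpha| <= d & attainable beta) ->
  attainable alpha.
Proof.
move=> cl eps eps0 M; have e20 : 0 < eps / 2 by lra.
have [beta ab attb] := cl _ e20; have [m Mm [x Hx]] := attb _ e20 M.
exists m => //; exists x; rewrite (deviation_shift phi alpha beta).
apply: le_trans (ler_normD _ _) _; rewrite normrM normr_nat.
have : m%:R * `|beta - alpha| <= m%:R * (eps / 2) by rewrite ler_wpM2l.
lra.
Qed.

Lemma attainable_bounded : exists E, forall alpha, attainable alpha ->
  `|alpha| <= E.
Proof.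
have [E E0 HE] := potential_bounded phi_uc 0; exists (E + 1) => alpha att.
have [m m0 [x Hx]] := att 1 ltr01 1%N.
have mp : 0 < m%:R :> R by rewrite ltr0n.
have := deviation_le m x HE.
rewrite (deviation_shift phi 0 alpha) subr0 => H0.
rewrite -(ler_pM2l mp) -{1}(normr_nat R m) -normrM.
have := ler_normB (dev alpha m x + m%:R * alpha) (dev alpha m x).
rewrite addrAC subrr add0r; lra.
Qed.

End Attainable.

(** A concave function on an interval is lower semicontinuous, even at the
    endpoints: towards any other point it stays above the chord. So upper
    semicontinuity is all that has to be proved. *)
Lemma concave_usc_continuous (R : realType) (I : set R) (f : R -> R) :
  (forall x, I x -> 0 <= f x) ->
  (forall t x y, 0 <= t <= 1 -> I x -> I y ->
     t * f x + (1 - t) * f y <= f (t * x + (1 - t) * y)) ->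
  (forall x h, I x -> f x < h -> exists2 d : R, 0 < d & forall y, I y ->
     `|y - x| <= d -> f y <= h) ->
  {within I, continuous f}.
Proof.
move=> f0 fconc fusc; apply/subspace_continuousP => x Ix.
apply/cvgrPdist_le => e e0; rewrite near_withinE.
have [d d0 Hd] := fusc x (f x + e) Ix ltac:(by rewrite ltrDl).
have chord b : I b -> b != x -> exists2 d : R, 0 < d & forall y, I y ->
    0 <= (y - x) / (b - x) -> `|y - x| <= d -> f x - e <= f y.
  move=> Ib bx; have bx0 : 0 < `|b - x| by rewrite normr_gt0 subr_eq0.
  have fx1 : 0 < f x + 1 by have := f0 x Ix; lra.
  exists (`|b - x| * Num.min 1 (e / (f x + 1))).
    by rewrite mulr_gt0// lt_min ltr01 divr_gt0.
  move=> y Iy; set t := (y - x) / (b - x) => t0 yd.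
  have t_le : t <= Num.min 1 (e / (f x + 1)).
    rewrite -(ger0_norm t0) normrM normfV ler_pdivrMr//.
    by rewrite mulrC.
  have [t1 te] : t <= 1 /\ t <= e / (f x + 1).
    by move: t_le; rewrite le_min => /andP[].
  have -> : y = (1 - t) * x + (1 - (1 - t)) * b.
    have : t * (b - x) = y - x by rewrite /t divfK// subr_eq0.
    by move=> H; have := H; lra.
  apply: le_trans _ (fconc _ _ _ _ Ix Ib); last by apply/andP; split; lra.
  have : 0 <= t * f b by rewrite mulr_ge0// f0.
  have : t * (f x + 1) <= e by rewrite -ler_pdivlMr.
  lra.
have side (s : R) : s != 0 -> exists2 d : R, 0 < d & forall y, I y ->
    0 < s * (y - x) -> `|y - x| <= d -> f x - e <= f y.
  move=> s0; have [[b Ib sb]|nb] := pselect (exists2 b, I b & 0 < s * (b - x)).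
    have bx : b != x by apply/eqP => E; move: sb; rewrite E subrr mulr0 ltxx.
    have [d' d'0 H] := chord b Ib bx; exists d' => // y Iy sy yd;
      apply: H => //.
    have -> : (y - x) / (b - x) = (s * (y - x)) / (s * (b - x)).
      by rewrite -mulf_div divff// mul1r.
    by rewrite divr_ge0// ltW.
  by exists 1 => // y Iy sy _; exfalso; apply: nb; exists y.
have [d1 d10 H1] := side 1 (oner_neq0 _).
have [d2 d20 H2] := side (-1) ltac:(by rewrite oppr_eq0 oner_eq0).
exists (Num.min d (Num.min d1 d2)) => /=; first by rewrite !lt_min d0 d10.
move=> y /= + Iy; rewrite distrC !lt_min => /and3P[yd yd1 yd2].
rewrite ler_distlC; have {}Hd := Hd y Iy (ltW yd).
rewrite Hd andbT; have [xy|yx|->] := ltgtP x y; last by lra.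
- by apply: H1 => //; rewrite ?mul1r ?subr_gt0// ltW.
- by apply: H2 => //; rewrite ?mulN1r ?opprB ?subr_gt0// ltW.
Qed.

(** * Counting codes on level sets *)

Lemma finite_uniform (I : finType) (P : I -> nat -> Prop) :
  (forall q, exists M, forall m, (M <= m)%N -> P q m) ->
  exists M, forall m, (M <= m)%N -> forall q, P q m.
Proof.
move=> /choice[M HM]; exists (\max_q M q)%N => m Mm q.
by apply: HM; apply: leq_trans Mm; exact: leq_bigmax.
Qed.

Section CodeCounting.
Context {R : realType} {A B : finType} (phi : (nat -> A) -> R).
Hypothesis phi_uc : letterwise_ucont phi.
Hypothesis A0 : (0 < #|A|)%N.
Variables (d : nat) (chi : 'I_d -> A -> B) (len : nat -> 'I_d -> nat).
Variable c : 'I_d -> R.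
Hypothesis d_gt0 : (0 < d)%N.
Hypothesis c_gt0 : forall q, 0 < c q.
Hypothesis len_c : forall n q, `|(len n q)%:R - c q * n%:R| <= 1.
Implicit Types (x y : nat -> A) (w : seq A) (alpha eps C t : R).

Local Notation dev := (deviation phi).
Local Notation attainable := (attainable phi).

Definition strips n : seq ((A -> B) * nat) :=
  [seq (chi q, len n q) | q <- enum 'I_d].

Definition code_at n x : seq B :=
  code (strips n) (mkseq x (strips_size (strips n))).

Definition birkhoff_level alpha : set (nat -> A) := [set x |
  forall eps, 0 < eps -> exists N, forall n, (N <= n)%N ->
    `|dev alpha n x| <= eps * n%:R].

Definition spectrum alpha : R :=
  \sum_(q < d) c q * level_entropy phi (chi q) alpha.

Let len_ub n q : (len n q)%:R <= c q * n%:R + 1.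
Proof. by have := len_c n q; rewrite ler_norml; lra. Qed.

Let len_lb n q : c q * n%:R - 1 <= (len n q)%:R.
Proof. by have := len_c n q; rewrite ler_norml; lra. Qed.

Let len_large M : exists n0, forall n, (n0 <= n)%N -> forall q, (M <= len n
  q)%N.
Proof.
apply: (@finite_uniform _ (fun q n => (M <= len n q)%N)) => q.
have [n0 H] := natr_large (M%:R + 1) (c_gt0 q); exists n0 => n /H Hn.
by rewrite -(ler_nat R); have := len_lb n q; lra.
Qed.

Let sum_len n (h : 'I_d -> R) :
  `|\sum_(q < d) h q * (len n q)%:R - (\sum_(q < d) c q * h q) * n%:R|
    <= \sum_(q < d) `|h q|.
Proof.
rewrite mulr_suml -sumrB; apply: le_trans (ler_norm_sum _ _ _) _.
apply: ler_sum => q _.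
have -> : h q * (len n q)%:R - c q * h q * n%:R
          = h q * ((len n q)%:R - c q * n%:R) by ring.
by rewrite normrM ler_piMr.
Qed.

Let strips_sizeS n : strips_size (strips n) = sumn [seq len n q | q <- enum
  'I_d].
Proof. by rewrite /strips_size /unzip2 /strips -map_comp. Qed.

Let strips_sizeE n : strips_size (strips n) = (\sum_(q < d) len n q)%N.
Proof.
by rewrite strips_sizeS sumnE big_map big_enum.
Qed.

Let unzip1_strips n (P : 'I_d -> set (seq A)) (qs : seq 'I_d) :
  unzip1 [seq (chi q, len n q, P q) | q <- qs] = [seq (chi q, len n q) | q <-
    qs].
Proof. by rewrite /unzip1 -map_comp. Qed.

(** Once the Birkhoff averages have settled near [alpha], the average over a
    strip is near [alpha] too, because the strip makes up a definite fraction
    of the time at which it ends. *)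
Let fits_settled alpha e (N n T : nat) (eps : 'I_d -> R) x qs :
  0 <= e -> (T = 0 \/ (N <= T)%N) -> (forall q, (N <= len n q)%N) ->
  (forall k, (N <= k)%N -> `|dev alpha k x| <= e * k%:R) ->
  (forall q, 2 * e * (T + sumn [seq len n q | q <- qs])%:R <= eps q * (len n
    q)%:R) ->
  fits [seq (chi q, len n q, near_word phi alpha (eps q)) | q <- qs]
    (mkseq (tail T x) (sumn [seq len n q | q <- qs])).
Proof.
move=> e0 + lenN xN; elim: qs T => [//|q qs IHqs] T TN He /=.
rewrite take_mkseq drop_mkseq tailD; split; last first.
  apply: IHqs; first by right; apply: leq_trans (lenN q) (leq_addl _ _).
  by move=> q'; have /= := He q'; rewrite addnA.
exists (tail T x); first exact: cylinder_mkseq.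
rewrite size_mkseq.
have dev_le k : k = 0 \/ (N <= k)%N -> `|dev alpha k x| <= e * k%:R.
  by move=> [->|/xN//]; rewrite deviation0 normr0 mulr0.
have HT := dev_le T TN.
have HT' : `|dev alpha (T + len n q) x| <= e * (T + len n q)%:R.
  by apply: dev_le; right; apply: leq_trans (lenN q) (leq_addl _ _).
have := He q; rewrite /= addnA.
move: HT'; rewrite deviationD; set u := dev _ _ _; set v := dev _ _ _ => HT'.
have := ler_normB (u + v) u; rewrite addrAC subrr add0r.
have : 0 <= e * (sumn [seq len n q | q <- qs])%:R by exact: mulr_ge0.
have : 0 <= e * (len n q)%:R by exact: mulr_ge0.
rewrite !natrD in HT' *; move: HT; rewrite -/u; lra.
Qed.

(** The upper estimate: a level set is a countable union of sets on which the
    averages settle at a known time, and these have few codes. *)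
Lemma birkhoff_level_cover alpha t : attainable alpha -> spectrum alpha < t ->
  exists F : nat -> set (nat -> A),
    birkhoff_level alpha `<=` \bigcup_N F N /\
    forall N, code_growth_le code_at t (F N).
Proof.
move=> att Ht; pose S := \sum_(q < d) c q.
have S0 : 0 <= S by apply: sumr_ge0 => q _; exact: ltW.
pose eta := (t - spectrum alpha) / (S + 1).
have eta0 : 0 < eta by rewrite divr_gt0 ?subr_gt0//; lra.
pose h q := level_entropy phi (chi q) alpha + eta.
have hsum : \sum_(q < d) c q * h q <= t.
  rewrite (eq_bigr _ (fun q _ => mulrDr _ _ _)) big_split/= -mulr_suml -/S.
  have : eta * (S + 1) = t - spectrum alpha by rewrite /eta divfK//; lra.
  by rewrite /spectrum; lra.
have /choice[eps /= Heps] q : exists e, 0 < e /\ exists C, forall m,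
    (proj_count (chi q) (near_word phi alpha e) m)%:R <= expR (h q * m%:R + C).
  have [|e e0 He] := @gt_level_entropy _ _ _ phi (chi q) alpha (h q) A0 att.
    by rewrite /h ltrDl.
  by exists e.
have {Heps}[eps0 /choice[C HC]] := all_and2 Heps.
(* For large [n] the strip [q] has length at least [c q * n / 2] and ends before
   [(S + 1) * n]; the deviation over it is a difference of two. *)
pose e := \big[Num.min/1]_(q < d) (eps q * c q / (4 * (S + 1))).
have den0 : 0 < 4 * (S + 1) by lra.
have e0 : 0 < e.
  apply: lt_bigmin => [|q _]; first exact: ltr01.
  by rewrite divr_gt0// mulr_gt0.
have eq q : 4 * (S + 1) * e <= eps q * c q.
  by rewrite mulrC -ler_pdivlMr//; exact: bigmin_le.
exists (fun N => [set x | forall k, (N <= k)%N -> `|dev alpha k x| <= e *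
  k%:R]).
split=> [x /(_ _ e0)[N HN]|N]; first by exists N.
have [n1 Hn1] := len_large N.
have [n2 Hn2] : exists n2, forall n, (n2 <= n)%N -> forall q, 2 <= c q * n%:R.
  apply: (@finite_uniform _ (fun q n => 2 <= c q * n%:R)) => q.
  exact: natr_large.
exists (\sum_(q < d) `|h q| + \sum_(q < d) C q), (n1 + n2 + d)%N =>
  n nn V uV VF.
have n1n : (n1 <= n)%N by apply: leq_trans nn; rewrite -addnA leq_addr.
have n2n : (n2 <= n)%N by apply: leq_trans nn; rewrite addnAC leq_addl.
have dn : (d <= n)%N by apply: leq_trans nn; rewrite leq_addl.
pose s := [seq (chi q, len n q, near_word phi alpha (eps q)) | q <- enum 'I_d].
have us : unzip1 s = strips n by exact: unzip1_strips.
have size_le : (size V <= size (codes s))%N.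
  apply: uniq_leq_size => // v /VF[x Fx ->].
  apply/mem_codes; rewrite us; exists (mkseq x (strips_size (strips n))).
  split=> //; first by rewrite size_mkseq.
  rewrite -[x in mkseq x]tail0 strips_sizeS.
  apply: (@fits_settled _ e N n 0 eps x _ (ltW e0)) => //.
  - by left.
  - exact: Hn1.
  move=> q; rewrite add0n.
  have -> : sumn [seq len n q | q <- enum 'I_d] = strips_size (strips n).
    by rewrite strips_sizeS.
  have total_le : (strips_size (strips n))%:R <= (S + 1) * n%:R.
    rewrite strips_sizeE natr_sum mulrDl mul1r mulr_suml.
    apply: le_trans (ler_sum _ (fun q _ => len_ub n q)) _.
    rewrite big_split/= lerD2l sumr_const card_ord.
    by rewrite ler_nat.
  have c2 := Hn2 n n2n q; have lb := len_lb n q.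
  have : 2 * e * (strips_size (strips n))%:R <= 2 * e * ((S + 1) * n%:R).
    by rewrite ler_wpM2l// mulr_ge0// ltW.
  have : 4 * (S + 1) * e * n%:R <= eps q * c q * n%:R by rewrite ler_wpM2r.
  have : eps q * (c q * n%:R) <= eps q * (2 * (len n q)%:R).
    by rewrite ler_wpM2l ?(ltW (eps0 q))//; lra.
  lra.
apply: le_trans (_ : _ <= (size (codes s))%:R) _; first by rewrite ler_nat.
rewrite size_codes big_map big_enum /= natr_prod.
apply: le_trans (_ : _ <= \prod_(q < d) expR (h q * (len n q)%:R + C q)) _.
  by apply: ler_prod => q _; rewrite ler0n HC.
rewrite -expR_sum ler_expR big_split/= addrA lerD2r.
have := sum_len n h; rewrite ler_norml => /andP[_].
have : (\sum_(q < d) c q * h q) * n%:R <= t * n%:R by rewrite ler_wpM2r.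
lra.
Qed.

Let code_merge (f : A -> B) a b s w :
  code ((f, a) :: (f, b) :: s) w = code ((f, a + b)%N :: s) w.
Proof. by rewrite /= catA -map_cat -takeD drop_drop addnC. Qed.

(** One step of the construction of a point avoiding [F]. Words extending [w]
    by steady strips have more codes than [F] can see, so one of them has a
    cylinder that misses [F]. *)
Let avoid (h : 'I_d -> R) alpha eps C t F w M :
  0 <= eps -> 0 <= C -> t < \sum_(q < d) c q * h q ->
  (forall q m, expR (h q * m%:R - C)
     <= (proj_count (chi q) (steady_word phi alpha eps C) m)%:R) ->
  code_growth_le code_at t F ->
  exists v, [/\ (M <= size v)%N, steady_word phi alpha eps (d%:R * C) v
              & forall x, cylinder (w ++ v) x -> ~ F x].
Proof.
move=> eps0 C0 tS HC [K [n0 HF]]; apply: contrapT => /forallNP nov.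
have [q0 [qs Eqs]] : exists q0 qs, enum 'I_d = q0 :: qs.
  case E : (enum 'I_d) => [|q0 qs]; last by exists q0, qs.
  by have := size_enum_ord d; rewrite E => d0; move: d_gt0; rewrite -d0.
have [n1 Hn1] := len_large (size w + M).
pose S := \sum_(q < d) c q * h q.
have St0 : 0 < S - t by rewrite subr_gt0.
pose K' := `|h q0| * (size w)%:R + d%:R * C + \sum_(q < d) `|h q|.
have [n2 Hn2] := natr_large (K + K' + 1) St0.
pose n := (n0 + n1 + n2)%N.
have n0n : (n0 <= n)%N by rewrite /n -addnA leq_addr.
have {}Hn1 q : (size w + M <= len n q)%N.
  by apply: Hn1; rewrite /n addnAC leq_addl.
have {}Hn2 : K + K' + 1 <= (S - t) * n%:R by apply: Hn2; rewrite /n leq_addl.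
pose P := steady_word phi alpha eps C.
have lw : (size w <= len n q0)%N by apply: leq_trans (Hn1 q0); rewrite leq_addr.
pose s' := (chi q0, (len n q0 - size w)%N, P)
             :: [seq (chi q, len n q, P) | q <- qs].
(* The given prefix is a strip of its own, with one admissible word. *)
pose s := (chi q0, size w, [set w]) :: s'.
have unzip_s : unzip1 s = [:: (chi q0, size w), (chi q0, len n q0 - size w)%N
                            & [seq (chi q, len n q) | q <- qs]].
  by rewrite -(unzip1_strips n (fun=> P)).
have code_s u : code (unzip1 s) u = code (strips n) u.
  by rewrite unzip_s code_merge subnKC// /strips Eqs.
have size_s : strips_size (unzip1 s) = strips_size (strips n).
  by rewrite unzip_s /strips Eqs /strips_size /= addnA subnKC.
have ss' : size s' = d by rewrite /= size_map; have := size_enum_ord d;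
  rewrite Eqs.
have Vle : (size (codes s))%:R <= expR (t * n%:R + K).
  apply: HF => //; first exact: undup_uniq.
  move=> v /mem_codes[u [su [uw fu] ->]].
  have su' : size (drop (size w) u) = strips_size (unzip1 s').
    by rewrite size_drop su /s /strips_size /= addKn.
  have Eu : u = w ++ drop (size w) u by rewrite -[LHS](cat_take_drop (size w))
    uw.
  have [x ux Fx] : exists2 x, cylinder u x & F x.
    apply: contrapT => nx; apply: (nov (drop (size w) u)); split.
    - rewrite su' /strips_size /= (leq_trans _ (leq_addr _ _))//.
      by rewrite leq_subRL.
    - rewrite -ss'; apply: steady_word_fits => //.
      move=> Q; rewrite /s' /= inE => /orP[/eqP->//|].
      by rewrite -map_comp => /mapP[q _ ->].
    - by move=> x; rewrite -Eu => ux Fx; apply: nx; exists x.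
  exists x => //; rewrite code_s /code_at -size_s -su.
  by congr code.
suff : expR (t * n%:R + K) < (size (codes s))%:R by lra.
rewrite size_codes /s big_cons natrM /= /s' big_cons big_map /= natrM natr_prod.
apply: lt_le_trans (_ : expR (h q0 * (len n q0 - size w)%:R - C) *
   \prod_(q <- qs) expR (h q * (len n q)%:R - C) <= _); last first.
  have H1 : 1 <= (proj_count (chi q0) [set w] (size w))%:R :> R.
    by rewrite ler1n; apply: (proj_count_gt0 _ (w := w)).
  rewrite -[leLHS]mul1r; apply: ler_pM => //.
    by rewrite mulr_ge0 ?expR_ge0// prodr_ge0// => q _; exact: expR_ge0.
  apply: ler_pM; rewrite ?expR_ge0 ?HC//.
    by rewrite prodr_ge0// => q _; exact: expR_ge0.
  by apply: ler_prod => q _; rewrite expR_ge0 HC.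
rewrite -expR_sum -expRD ltr_expR.
have -> : h q0 * (len n q0 - size w)%:R - C + \sum_(q <- qs) (h q * (len n
  q)%:R - C)
   = \sum_(q < d) h q * (len n q)%:R - d%:R * C - h q0 * (size w)%:R.
  have -> : \sum_(q < d) h q * (len n q)%:R - d%:R * C
            = \sum_(q < d) (h q * (len n q)%:R - C).
    by rewrite sumrB sumr_const card_ord mulr_natl.
  have -> (G : 'I_d -> R) : \sum_(q < d) G q = \sum_(q <- enum 'I_d) G q.
    by rewrite big_enum.
  by rewrite Eqs big_cons natrB//; ring.
have : h q0 * (size w)%:R <= `|h q0| * (size w)%:R.
  by rewrite ler_wpM2r// ler_norm.
have := sum_len n h; rewrite ler_norml => /andP[+ _]; rewrite -/S.
rewrite /K' in Hn2; lra.
Qed.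

(** The lower estimate, in the form of a Baire category argument: a point of
    the level set outside all [F i] is built by extending a word stage by
    stage, missing [F i] at stage [i]. The tolerance decreases along the stages,
    and a stage is long enough to make the deviation inherited from the earlier
    ones negligible, as well as the constant of the next. *)
Lemma birkhoff_level_not_covered alpha t (F : nat -> set (nat -> A)) :
  attainable alpha -> t < spectrum alpha -> (forall i, code_growth_le code_at
    t (F i)) ->
  exists2 x, birkhoff_level alpha x & forall i, ~ F i x.
Proof.
move=> att Ht HF; have [a _] := card_gt0P A0.
have [E' E'0 HE'] := potential_bounded phi_uc alpha.
pose E := E' + 1; have E0 : 0 < E by rewrite /E; lra.
have HE x : `|phi x - alpha| <= E by apply: le_trans (HE' x) _; rewrite lerDl.
pose S := \sum_(q < d) c q.
have S0 : 0 <= S by apply: sumr_ge0 => q _; exact: ltW.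
pose eta := (spectrum alpha - t) / (S + 1).
have eta0 : 0 < eta by rewrite divr_gt0 ?subr_gt0//; lra.
pose h q := level_entropy phi (chi q) alpha - eta.
have hsum : t < \sum_(q < d) c q * h q.
  rewrite (eq_bigr _ (fun q _ => mulrBr _ _ _)) sumrB -mulr_suml -/S.
  have : eta * (S + 1) = spectrum alpha - t by rewrite /eta divfK//; lra.
  by rewrite /spectrum; lra.
(* As [E] bounds the centred potential, every word has the deviation required
   at stage 0. *)
pose eps i : R := E / i.+1%:R.
have eps0 i : 0 < eps i by rewrite divr_gt0.
have eps_le i j : (i <= j)%N -> eps j <= eps i.
  by move=> ij; rewrite /eps ler_pM2l// lef_pV2 ?posrE// ler_nat.
have /choice[C HC] i : exists C, 0 <= C /\ forall q m, expR (h q * m%:R - C)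
     <= (proj_count (chi q) (steady_word phi alpha (eps i) C) m)%:R.
  have /choice[Cq HCq] q : exists C, 0 <= C /\ forall m, expR (h q * m%:R - C)
     <= (proj_count (chi q) (steady_word phi alpha (eps i) C) m)%:R.
    have rq : level_rate phi (chi q) alpha (h q).
      by apply: lt_level_entropy => //; rewrite /h ltrBlDr ltrDl.
    by have [C C0 H] := steady_count phi_uc rq (eps0 i); exists C.
  have Cq_ge0 q : 0 <= Cq q by have [] := HCq q.
  exists (\sum_q Cq q); split=> [|q m]; first exact: sumr_ge0.
  have CqS : Cq q <= \sum_q Cq q by rewrite (bigD1 q)//= lerDl sumr_ge0.
  have [_ /(_ m) H] := HCq q.
  apply: le_trans (_ : _ <= expR (h q * m%:R - Cq q)) _.
    by rewrite ler_expR lerD2l lerN2.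
  apply: le_trans H _; rewrite ler_nat; apply: proj_count_sub => w _.
  exact: steady_word_le.
pose D i := d%:R * C i.
have C0 i : 0 <= C i by have [] := HC i.
have D0 i : 0 <= D i by exact: mulr_ge0.
pose Inv i w := [/\ (forall x, cylinder w x ->
    `|dev alpha (size w) x| <= 2 * eps i * (size w)%:R),
  D i.+1 <= eps i * (size w)%:R & (i <= size w)%N].
have /choice[f Hf] (iw : nat * seq A) : exists v, Inv iw.1 iw.2 ->
  [/\ Inv iw.1.+1 (iw.2 ++ v),
      (forall x k, cylinder (iw.2 ++ v) x ->
         (size iw.2 <= k <= size (iw.2 ++ v))%N ->
         `|dev alpha k x| <= 3 * eps iw.1 * k%:R) &
      forall x, cylinder (iw.2 ++ v) x -> ~ F iw.1 x].
  case: iw => i w /=.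
  have [[inv1 inv2 inv3]|ninv] := pselect (Inv i w); last by exists [::].
  have [M HM] := natr_large
    (2 * eps i * (size w)%:R + D i.+1 + D i.+2) (eps0 i.+1).
  have [_ HCi] := HC i.+1.
  have [v [Mv v_steady v_avoid]] :=
    avoid w M.+1 (ltW (eps0 i.+1)) (C0 _) hsum HCi (HF i).
  exists v => _; have eii : eps i.+1 <= eps i by exact: eps_le.
  have w0 : 0 <= (size w)%:R :> R by [].
  have {}HM := HM (size v) (ltnW Mv).
  have dev_le x l : cylinder (w ++ v) x -> (l <= size v)%N ->
      `|dev alpha (size w + l) x|
        <= 2 * eps i * (size w)%:R + (eps i.+1 * l%:R + D i.+1).
    move=> /cylinder_cat[xw xv] lv; rewrite deviationD.
    apply: le_trans (ler_normD _ _) _; apply: lerD; first exact: inv1.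
    exact: v_steady.
  have ei0 := eps0 i.+1.
  have ew : 0 <= eps i * (size w)%:R by rewrite mulr_ge0// ltW.
  have ew' : 0 <= eps i.+1 * (size w)%:R by rewrite mulr_ge0// ltW.
  have ev' : 0 <= eps i.+1 * (size v)%:R by rewrite mulr_ge0// ltW.
  split=> //.
    split.
    - move=> x xwv; rewrite size_cat;
      apply: le_trans (dev_le _ _ xwv (leqnn _)) _.
      by have := D0 i.+2; rewrite natrD; lra.
    - by rewrite size_cat natrD; have := D0 i.+1; lra.
    - by rewrite size_cat -addn1 leq_add// (leq_ltn_trans _ Mv).
  move=> x k xwv; rewrite size_cat => /andP[wk].
  rewrite -(subnKC wk) leq_add2l; set l := (k - size w)%N => lv.
  apply: le_trans (dev_le _ _ xwv lv) _; rewrite natrD.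
  have : eps i.+1 * l%:R <= eps i * l%:R by rewrite ler_wpM2r.
  have : 0 <= eps i * l%:R by rewrite mulr_ge0// ltW.
  lra.
have [M HM] := natr_large (D 1) (eps0 0).
pose W := fix W i := if i is i'.+1 then W i' ++ f (i', W i') else nseq M a.
have WInv i : Inv i (W i).
  elim: i => [|i IHi]; last by have [] := Hf (i, W i) IHi.
  split=> //=; last by rewrite size_nseq; exact: HM.
  move=> x _; apply: le_trans (deviation_le _ x HE) _.
  rewrite /eps divr1 mulrC ler_wpM2r//; lra.
have W_step i : _ := Hf (i, W i) (WInv i).
have nth_W i k j : (j < size (W i))%N -> nth a (W (i + k)%N) j = nth a (W i) j.
  move=> jW; elim: k => [|k IHk]; first by rewrite addn0.
  rewrite addnS /= nth_cat IHk ifT//.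
  elim: k {IHk} => [|k IHk]; first by rewrite addn0.
  by rewrite addnS /= size_cat ltn_addr.
have sW i : (i <= size (W i))%N by have [] := WInv i.
pose x j := nth a (W j.+1) j.
have xW i : cylinder (W i) x.
  apply: (@eq_from_nth _ a); rewrite size_mkseq// => j jW.
  rewrite nth_mkseq// /x; have [ij|ji] := leqP i j.+1.
    by rewrite -(subnKC ij) nth_W.
  by rewrite -(subnKC (ltnW ji)) nth_W// (leq_trans _ (sW _)).
exists x => [e e0|i]; last first.
  by have [_ _] := W_step i; apply; exact: (xW i.+1).
have [i Hi] : exists i, 3 * eps i <= e.
  have [i Hi] := natr_large (3 * E) e0; exists i.
  rewrite /eps mulrA ler_pdivrMr//; apply: le_trans (Hi i (leqnn _)) _.
  by rewrite ler_wpM2l ?(ltW e0)// ler_nat.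
exists (size (W i)) => n Wn.
have : (n <= size (W (i + n)%N))%N by apply: leq_trans (sW _); rewrite leq_addl.
elim: {2}n => [|k IHk] nk.
  have [H _ _] := WInv i.
  have <- : size (W i) = n by apply/eqP; rewrite eqn_leq Wn;
    rewrite addn0 in nk.
  apply: le_trans (H _ (xW i)) _; apply: ler_wpM2r => //.
  by apply: le_trans Hi; rewrite ler_wpM2r ?(ltW (eps0 i))//; lra.
have [/IHk//|Wk] := leqP n (size (W (i + k)%N)).
rewrite addnS in nk.
have [_ /(_ x n (xW (i + k).+1)) + _] := W_step (i + k)%N.
rewrite (ltnW Wk) => /(_ nk) /le_trans; apply; apply: ler_wpM2r => //.
by apply: le_trans Hi; rewrite ler_wpM2l// eps_le// leq_addr.
Qed.

End CodeCounting.

(** * Geometry of the coding map *)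

Section Expansion.
Context {R : realType} (b : nat) (e f : nat -> nat).
Hypothesis b_gt0 : (0 < b)%N.
Hypotheses (e_lt : forall n, (e n < b)%N) (f_lt : forall n, (f n < b)%N).

Fixpoint base_prefix (e : nat -> nat) L : nat :=
  if L is L'.+1 then (base_prefix e L' * b + e L')%N else 0%N.

Lemma base_prefix_bounds L M :
  (base_prefix e L * b ^ M <= base_prefix e (L + M)
     < (base_prefix e L).+1 * b ^ M)%N.
Proof.
elim: M => [|M /andP[IH1 IH2]]; first by rewrite addn0 !muln1 leqnn ltnS leqnn.
rewrite addnS expnSr /= !mulnA (leq_trans _ (leq_addr _ _)) ?leq_mul//=.
apply: (@leq_trans ((base_prefix e (L + M)).+1 * b)); last by rewrite leq_mul.
by rewrite mulSn addnC ltn_add2r.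
Qed.

Lemma base_prefix_lt L : (base_prefix e L < b ^ L)%N.
Proof. by have /andP[_] := base_prefix_bounds 0 L; rewrite mul1n. Qed.

Lemma base_prefix_eq L : base_prefix e L = base_prefix f L <->
  forall i, (i < L)%N -> e i = f i.
Proof.
elim: L => [//|L IHL] /=; split=> [E i|ef]; last first.
  by rewrite ef// (IHL.2 _)// => i iL; rewrite ef// ltnW.
have E1 : base_prefix e L = base_prefix f L.
  by have := congr1 (divn^~ b) E; rewrite !divnMDl// !divn_small// !addn0.
rewrite ltnS leq_eqVlt => /orP[/eqP ->|]; last exact: IHL.1.
by have := E; rewrite E1 => /addnI.
Qed.

Definition expansion : R := limn (series (fun n =>
  (e n)%:R / b%:R ^+ n.+1 : R)).

Lemma series_expansion L :
  series (fun n => (e n)%:R / b%:R ^+ n.+1 : R) L = (base_prefix e L)%:R /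
    b%:R ^+ L.
Proof.
have b0 : b%:R != 0 :> R by rewrite pnatr_eq0 -lt0n.
elim: L => [|L IHL]; first by rewrite /series/= big_nil mul0r.
rewrite /series/= big_nat_recr//= -/(series _ L) [X in X + _]IHL.
by rewrite natrD natrM exprSr; field; rewrite b0 expf_neq0.
Qed.

(** The digits after the first [L] contribute at most one unit of the last of
    these. The upper bound is not strict, because all of them can be [b - 1]. *)
Lemma expansion_bounds L :
  (base_prefix e L)%:R <= b%:R ^+ L * expansion <= (base_prefix e L)%:R + 1.
Proof.
have b0 k : 0 < b%:R ^+ k :> R by rewrite exprn_gt0// ltr0n.
have upper M : series (fun n => (e n)%:R / b%:R ^+ n.+1 : R) (L + M)
    <= ((base_prefix e L)%:R + 1) / b%:R ^+ L.
  rewrite series_expansion ler_pdivrMr// exprD mulrA divfK ?gt_eqF//.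
  have /andP[_ /ltnW] := base_prefix_bounds L M.
  by rewrite -(ler_nat R) natrM natrX -natr1.
have lower M : (base_prefix e L)%:R / b%:R ^+ L
    <= series (fun n => (e n)%:R / b%:R ^+ n.+1 : R) (L + M).
  rewrite series_expansion ler_pdivlMr// exprD mulrA divfK ?gt_eqF//.
  have /andP[+ _] := base_prefix_bounds L M.
  by rewrite -(ler_nat R) natrM natrX.
have cvg_series : cvgn (series (fun n => (e n)%:R / b%:R ^+ n.+1 : R)).
  apply: nondecreasing_is_cvgn.
    by apply: nondecreasing_series => i _ _; rewrite divr_ge0// exprn_ge0.
  exists 1 => _ [M _ <-];
    rewrite series_expansion ler_pdivrMr// mul1r -natrX ler_nat.
  exact: ltnW (base_prefix_lt M).
apply/andP; split.
  rewrite mulrC -ler_pdivrMr//; apply: limr_ge => //.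
  by exists L => // n /= Ln; rewrite -(subnKC Ln).
rewrite mulrC -ler_pdivlMr//; apply: limr_le => //.
by exists L => // n /= Ln; rewrite -(subnKC Ln).
Qed.

End Expansion.

(** Of the [N] consecutive intervals of a circle of length [N], two distinct
    ones of the same colour do not touch: colours alternate, except for the last
    interval, which has a colour of its own. *)
Definition circle_colour (N k : nat) : 'I_3 :=
  if k.+1 == N then ord_max else inord (k %% 2).

Lemma circle_colour_gap N k k' : (k < N)%N -> (k' < N)%N -> k <> k' ->
  circle_colour N k = circle_colour N k' ->
  (k + 2 <= k' /\ k' + 2 <= N \/ k' + 2 <= k /\ k + 2 <= N)%N.
Proof.
move=> kN kN' kk'; rewrite /circle_colour.
have inord2 m : nat_of_ord (inord (m %% 2) : 'I_3) = (m %% 2)%N.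
  by rewrite inordK// (leq_trans (ltn_pmod m (isT : (0 < 2)%N))).
case: eqP => [Ek|nk]; case: eqP => [Ek'|nk'] /(congr1 (@nat_of_ord 3)) /=.
- lia.
- by rewrite inord2; lia.
- by rewrite inord2; lia.
- by rewrite !inord2; lia.
Qed.

Lemma circle_gap (R : realType) (N k k' : nat) (y y' : R) (m : int) :
  (k + 2 <= k')%N -> (k' + 2 <= N)%N ->
  k%:R <= y <= k%:R + 1 -> k'%:R <= y' <= k'%:R + 1 ->
  1 <= `|y - y' + m%:~R * N%:R|.
Proof.
rewrite -!(ler_nat R) !natrD => kk' k'N yk yk'.
have k0 : 0 <= k%:R :> R by [].
have [m0|m0] := leP m 0.
  rewrite -normrN (le_trans _ (ler_norm _))//.
  have : m%:~R * N%:R <= 0 :> R by rewrite mulr_le0_ge0// lerz0.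
  lra.
rewrite (le_trans _ (ler_norm _))//.
have : 1 * N%:R <= m%:~R * N%:R :> R by rewrite ler_wpM2r// (ler_int R 1).
lra.
Qed.

Lemma enorm_le_max (R : realType) (d : nat) (x : 'rV[R]_d) (e : R) : 0 <= e ->
  (forall j, `|x ord0 j| <= e) -> enorm x <= d%:R * e.
Proof.
move=> e0 xe; have de0 : 0 <= d%:R * e by exact: mulr_ge0.
rewrite /enorm -[leRHS]ger0_norm// -sqrtr_sqr ler_wsqrtr//.
apply: le_trans (_ : _ <= \sum_(j < d) e ^+ 2) _.
  by apply: ler_sum => j _; rewrite -real_normK ?num_real// lerXn2r ?nnegrE.
rewrite sumr_const card_ord -[_ *+ _]mulr_natl exprMn ler_wpM2r ?exprn_ge0//.
by rewrite -natrX ler_nat -{1}[d]expn1; case: d {x xe de0} => // d;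
  rewrite leq_pexp2l.
Qed.

Section SpongeGeometry.
Context {R : realType} {d : nat} {a : 'I_d -> nat}.
Context {D : {set {dffun forall q : 'I_d, 'I_(a q)}}} (D0 : D != finset.set0).
Hypothesis a_decr : forall p q : 'I_d, (p < q)%N -> (a q < a p)%N.
Hypothesis a_ge2 : forall q : 'I_d, (2 <= a q)%N.
Implicit Types (x y : nat -> alphabet D0) (j q : 'I_d).

Definition letter_digit (l : alphabet D0) j : nat :=
  (val l : {dffun forall q : 'I_d, 'I_(a q)}) j.

Let digit_lt x j i : (letter_digit (x i) j < a j)%N.
Proof. exact: ltn_ord. Qed.

(** The projection is encoded by its fibres, which avoids a separate alphabet
    for each [q]. *)
Definition forget_below q (l : alphabet D0) : {set alphabet D0} :=
  [set l' | [forall j : 'I_d, (q <= j)%N ==> (letter_digit l' j ==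
    letter_digit l j)]].

Lemma forget_below_eq q l l' : forget_below q l = forget_below q l' <->
  forall j, (q <= j)%N -> letter_digit l j = letter_digit l' j.
Proof.
split=> [E j qj|ll'].
  have : l \in forget_below q l' by rewrite -E inE; apply/forallP => k;
    rewrite eqxx implybT.
  by rewrite inE => /forallP/(_ j); rewrite qj => /eqP.
apply/setP => l''; rewrite !inE; apply/forallP/forallP => H j; have := H j.
  by have [qj|] := leqP q j; rewrite //= ll'.
by have [qj|] := leqP q j; rewrite //= ll'.
Qed.

(** At the scale [expR (- n)] the coordinate [j] is determined by its first
    [level_length n j.+1] digits. The index is shifted by one, so that the strip
    [q] lies between the lengths of indices [q] and [q.+1]. *)
Definition level_length n k : nat :=
  if k is k'.+1 then
    if insub k' is Some j then (Num.truncn (n%:R / ln (a j)%:R : R)).+1 else 0%N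
  else 0%N.

Definition inv_log k : R :=
  if k is k'.+1 then if insub k' is Some j then (ln (a j)%:R)^-1 else 0 else 0.

Definition strip_length n q : nat := (level_length n q.+1 - level_length n q)%N.

Definition strip_weight q : R := inv_log q.+1 - inv_log q.

Let ln_gt0 j : 0 < ln (a j)%:R :> R.
Proof. by rewrite ln_gt0// ltr1n. Qed.

Lemma inv_logS j : inv_log j.+1 = (ln (a j)%:R)^-1.
Proof. by rewrite /= valK. Qed.

Lemma level_lengthS n j :
  level_length n j.+1 = (Num.truncn (n%:R / ln (a j)%:R : R)).+1.
Proof. by rewrite /= valK. Qed.

Lemma inv_log_lt q : inv_log q < inv_log q.+1.
Proof.
rewrite inv_logS; case: q => [[|k] kd]; first by rewrite invr_gt0 ln_gt0.
have kd' : (k < d)%N by exact: ltnW.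
rewrite (inv_logS (Ordinal kd')) ltf_pV2 ?posrE ?ln_gt0// ltr_ln ?posrE ?ltr0n.
- by rewrite ltr_nat; exact: a_decr.
- exact: leq_trans (a_ge2 _).
- exact: leq_trans (a_ge2 _).
Qed.

Lemma strip_weight_gt0 q : 0 < strip_weight q.
Proof. by rewrite subr_gt0 inv_log_lt. Qed.

Lemma level_length_bounds n k :
  inv_log k * n%:R <= (level_length n k)%:R <= inv_log k * n%:R + 1.
Proof.
case: k => [|k] /=; first by rewrite mul0r lexx add0r ler01.
case: insubP => [j _ _|_]; last by rewrite mul0r lexx add0r ler01.
rewrite mulrC ltW ?truncnS_gt//= -natr1 lerD2r truncn_le.
by rewrite divr_ge0// ltW// ln_gt0.
Qed.

Lemma level_length_mono n q : (level_length n q <= level_length n q.+1)%N.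
Proof.
have := inv_log_lt q; rewrite inv_logS level_lengthS.
case: q => [[|k] kd] //; have kd' : (k < d)%N by exact: ltnW.
rewrite (inv_logS (Ordinal kd')) (level_lengthS n (Ordinal kd')) => lt.
by rewrite ltnS le_truncn// ler_wpM2l// ltW.
Qed.

Lemma strip_length_weight n q :
  `|(strip_length n q)%:R - strip_weight q * n%:R| <= 1.
Proof.
rewrite /strip_length natrB ?level_length_mono// /strip_weight mulrBl ler_norml.
have := level_length_bounds n q; have := level_length_bounds n q.+1.
by move=> /andP[? ?] /andP[? ?]; apply/andP; split; lra.
Qed.

Local Notation strips := (strips forget_below strip_length).
Local Notation code_at := (code_at forget_below strip_length).

Let strips_size_take n k : (k <= d)%N ->
  strips_size (take k (strips n)) = level_length n k.
Proof.
elim: k => [|k IHk] kd; first by rewrite take0.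
have j0 : 'I_d by exact: Ordinal kd.
have kS : (k < size (strips n))%N by rewrite size_map size_enum_ord.
rewrite (take_nth (forget_below j0, 0%N) kS).
rewrite /strips_size /unzip2 map_rcons sumn_rcons -/(unzip2 _).
rewrite -/(strips_size _) IHk ?(ltnW kd)// (nth_map j0) ?size_enum_ord//=.
have -> : nth j0 (enum 'I_d) k = Ordinal kd by apply: val_inj;
  rewrite /= nth_enum_ord.
by rewrite subnKC// (level_length_mono n (Ordinal kd)).
Qed.

(** The points with the same code at level [n] form an approximate square: they
    agree on the digits that matter at the scale [expR (- n)]. *)
Lemma code_at_eq n x y : code_at n x = code_at n y <->
  forall j i, (i < level_length n j.+1)%N ->
    letter_digit (x i) j = letter_digit (y i) j.
Proof.
rewrite /code_at code_eq; split=> [H j i ij|H q dq].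
  have [q qj /andP[qi iq]] : exists2 q : 'I_d, (q <= j)%N &
      (level_length n q <= i < level_length n q.+1)%N.
    move: ij; case: j => k; elim: k => [|k IHk] kd ik;
      first by exists (Ordinal kd).
    have [ki|ik'] := leqP (level_length n k.+1) i.
      by exists (Ordinal kd) => //=; rewrite ki.
    have [q qk Hq] := IHk (ltnW kd) ik'; exists q => //.
    exact: leq_trans qk (leqnSn _).
  have := H q (forget_below q, 0%N); rewrite size_map size_enum_ord ltn_ord.
  rewrite (nth_map q) ?size_enum_ord// nth_ord_enum =>
    /(_ isT (i - level_length n q)%N).
  rewrite strips_size_take ?(ltnW (ltn_ord q))//= subnKC//.
  by rewrite /strip_length ltn_sub2rE// => /(_ iq)/forget_below_eq; apply.
rewrite size_map size_enum_ord => qd i.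
rewrite (nth_map (Ordinal qd)) ?size_enum_ord// strips_size_take ?(ltnW qd)//=.
have -> : nth (Ordinal qd) (enum 'I_d) q = Ordinal qd.
  by apply: val_inj; rewrite /= nth_enum_ord.
move=> iq; apply/forget_below_eq => j /= qj; apply: H.
have qi : (level_length n q + i < level_length n q.+1)%N.
  by rewrite -ltn_subRL.
apply: leq_trans qi _; move: qj; case: j => k kd /= qk.
elim: k kd qk => [|k IHk] kd; first by rewrite leqn0 => /eqP ->.
rewrite leq_eqVlt => /orP[/eqP ->//|]; rewrite ltnS => qk.
apply: leq_trans (IHk (ltnW kd) qk) _.
exact: (level_length_mono n (Ordinal kd)).
Qed.

Local Notation coordinate x j := (expansion (R := R) (a j) (fun i =>
  letter_digit (x i) j)).
Local Notation prefix_value n x j :=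
  (base_prefix (a j) (fun i => letter_digit (x i) j) (level_length n j.+1)).

Let coding_mapE x : coding_map (R := R) (D0 := D0) x = torus_proj (\row_j
  coordinate x j).
Proof. by []. Qed.

Let a_gt0 j : (0 < a j)%N.
Proof. exact: leq_trans (a_ge2 j). Qed.

Let coordinate_bounds n x j :
  (prefix_value n x j)%:R <= (a j)%:R ^+ level_length n j.+1 * coordinate x j
    <= (prefix_value n x j)%:R + 1.
Proof. exact: expansion_bounds. Qed.

Let scale_bounds n j :
  expR (n%:R : R) <= (a j)%:R ^+ level_length n j.+1 <= (a j)%:R * expR (n%:R
    : R).
Proof.
have aE : (a j)%:R = expR (ln (a j)%:R) :> R by rewrite lnK// posrE ltr0n.
have /andP[lb ub] := level_length_bounds n j.+1; rewrite inv_logS in lb ub.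
have -> : (a j)%:R ^+ level_length n j.+1
    = expR ((level_length n j.+1)%:R * ln (a j)%:R) :> R by rewrite expRM_natl
      -aE.
have -> : (a j)%:R * expR n%:R = expR (ln (a j)%:R + n%:R) :> R by rewrite
  expRD -aE.
rewrite !ler_expR; apply/andP; split.
  by rewrite mulrC -ler_pdivrMl.
by rewrite mulrC -ler_pdivlMl// mulrDr mulVf ?gt_eqF// addrC.
Qed.

Lemma coding_map_close n x y : code_at n x = code_at n y ->
  mdist (coding_map (R := R) (D0 := D0) x) (coding_map (D0 := D0) y)
    <= d%:R * expR (- n%:R).
Proof.
move=> /code_at_eq xy; rewrite !coding_mapE.
have -> : mdist (torus_proj (\row_j coordinate x j)) (torus_proj (\row_j
  coordinate y j))
   = torus_norm (torus_proj (\row_j coordinate x j) - torus_proj (\row_j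
     coordinate y j)).
  by [].
rewrite -torus_projN -torus_projD; apply: le_trans (torus_norm_le _) _.
apply: enorm_le_max => [|j]; first exact: expR_ge0.
rewrite !mxE; have := coordinate_bounds n x j; have := coordinate_bounds n y j.
have -> : prefix_value n x j = prefix_value n y j by apply/base_prefix_eq =>
  // i; exact: xy.
have /andP[+ _] := scale_bounds n j; set N := _ ^+ _; set k := _%:R => nN yk xk.
have N0 : 0 < N by apply: lt_le_trans nN; exact: expR_gt0.
apply: le_trans (_ : _ <= N^-1) _;
  last by rewrite expRN lef_pV2 ?posrE ?expR_gt0.
rewrite -[leRHS]mul1r ler_pdivlMr// -[X in _ * X](gtr0_norm N0) -normrM
  ler_norml.
by move: xk yk => /andP[? ?] /andP[? ?]; apply/andP; split; lra.
Qed.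

Definition cell_colour n x : {ffun 'I_d -> 'I_3} :=
  [ffun j => circle_colour (a j ^ level_length n j.+1) (prefix_value n x j)].

(** Two points with different codes lie in different cells for some coordinate;
    when these cells have the same colour, they do not touch. *)
Lemma coding_map_sep n x y : cell_colour n x = cell_colour n y ->
  code_at n x <> code_at n y ->
  (\sum_j a j).+1%:R^-1 * expR (- n%:R)
    <= mdist (coding_map (R := R) (D0 := D0) x) (coding_map (D0 := D0) y).
Proof.
move=> cxy /code_at_eq /existsNP[j xy].
have kk : prefix_value n x j <> prefix_value n y j by move=> /(base_prefix_eq
  (a_gt0 j) (digit_lt x j) (digit_lt y j) _).
have {}cxy : circle_colour (a j ^ level_length n j.+1) (prefix_value n x j)
           = circle_colour (a j ^ level_length n j.+1) (prefix_value n y j).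
  by have := congr1 (fun f : {ffun 'I_d -> 'I_3} => f j) cxy; rewrite !ffunE.
have := circle_colour_gap (base_prefix_lt (digit_lt x j) _)
  (base_prefix_lt (digit_lt y j) _) kk cxy.
rewrite !coding_mapE => gap.
have -> : mdist (torus_proj (\row_j coordinate x j)) (torus_proj (\row_j
  coordinate y j))
   = torus_norm (torus_proj (\row_j coordinate x j) - torus_proj (\row_j
     coordinate y j)).
  by [].
rewrite -torus_projN -torus_projD; apply: lb_le_inf.
  by exists (enorm (\row_j coordinate x j - \row_j coordinate y j)), (\row_j
    coordinate x j - \row_j coordinate y j).
move=> _ [z /= /torus_projP/(_ j) + <-]; rewrite !mxE => /intrP[m Em].
apply: le_trans (le_coord_enorm z j).
have {Em} -> : z ord0 j = coordinate x j - coordinate y j + m%:~R.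
  by rewrite -Em; ring.
have := coordinate_bounds n x j; have := coordinate_bounds n y j.
have /andP[nN Nn] := scale_bounds n j; move: gap nN Nn.
rewrite -natrX; set N := (_ ^ _)%N => gap nN Nn yk xk.
have N0 : 0 < N%:R :> R by apply: lt_le_trans nN; exact: expR_gt0.
apply: le_trans (_ : _ <= N%:R^-1) _.
  rewrite expRN -invfM lef_pV2 ?posrE ?mulr_gt0 ?expR_gt0//.
  apply: le_trans Nn _; rewrite ler_wpM2r ?expR_ge0// ler_nat.
  by rewrite (bigD1 j)//= leqW// leq_addr.
rewrite -[leLHS]mul1r ler_pdivrMr// -[X in _ * X](gtr0_norm N0) -normrM.
have -> : (coordinate x j - coordinate y j + m%:~R) * N%:R
  = N%:R * coordinate x j - N%:R * coordinate y j + m%:~R * N%:R by ring.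
case: gap => [[g1 g2]|[g1 g2]]; first exact: circle_gap g1 g2 xk yk.
rewrite -normrN.
have -> : - (N%:R * coordinate x j - N%:R * coordinate y j + m%:~R * N%:R)
  = N%:R * coordinate y j - N%:R * coordinate x j + (- m)%:~R * N%:R.
  by rewrite mulrNz mulNr opprD opprB.
exact: circle_gap g1 g2 yk xk.
Qed.

End SpongeGeometry.

(** * Topology of the symbolic space *)

Section SymbolicTopology.
Context {d : nat} {a : 'I_d -> nat}.
Context {D : {set {dffun forall q : 'I_d, 'I_(a q)}}} (D0 : D != finset.set0).

Local Notation A := (alphabet D0).
Local Notation Sigma := (symbolic_space D0).
Implicit Types (x y : Sigma) (w : seq A).

Lemma letter_clopen i (P : set A) : clopen ([set x | P (x i)] : set Sigma).
Proof.
have ci : continuous ((fun x => x i) : Sigma -> discrete_topology A).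
  exact: (@proj_continuous nat (fun=> discrete_topology A) i).
split.
  exact: (open_comp (fun x _ =>
    ci x) (discrete_open (P : set (discrete_topology A)))).
exact: (closed_comp (fun x _ =>
  ci x) (discrete_closed (P : set (discrete_topology A)))).
Qed.

Lemma cylinder_clopen w : clopen (cylinder w : set Sigma).
Proof.
elim/last_ind: w => [|w l IHw].
  by rewrite (_ : cylinder _ = setT); [split;
    [exact: openT|exact: closedT]|apply/seteqP; split].
rewrite (_ : cylinder _ = cylinder w `&` [set x | x (size w) = l]); last first.
  apply/seteqP; split=> x; rewrite -cats1.
    by move=> /cylinder_cat[? []]; rewrite /tail addn0; split.
  move=> [? xl]; apply/cylinder_cat; split=> //; rewrite /cylinder/=.
  by congr [:: _]; rewrite /tail addn0.
have [wo wc] := IHw; have [lo lc] := letter_clopen (size w) [set l].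
by split; [exact: openI|exact: closedI].
Qed.

(** The filter generated by the cylinders around [x] converges to [x] in every
    coordinate, hence in the product topology. *)
Lemma nbhs_cylinder x (U : set Sigma) : nbhs x U ->
  exists n, cylinder (mkseq x n) `<=` U.
Proof.
pose F : set_system Sigma := [set V | exists n, cylinder (mkseq x n) `<=` V].
have cylinder_anti n m : (n <= m)%N -> cylinder (mkseq x m) `<=` cylinder
  (mkseq x n).
  move=> nm; rewrite -(subnKC nm) mkseq_add => y /cylinder_cat[].
  by rewrite size_mkseq.
have FF : Filter F.
  split; first by exists 0%N.
    move=> P Q [n nP] [m mQ]; exists (maxn n m) => y H; split.
      by apply/nP/(cylinder_anti _ _ _ _ H); rewrite leq_maxl.
    by apply/mQ/(cylinder_anti _ _ _ _ H); rewrite leq_maxr.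
  by move=> P Q PQ [n nP]; exists n; exact: subset_trans PQ.
suff : F --> (x : Sigma) by apply.
apply/cvg_sup => i; apply/cvg_image.
  by apply/seteqP; split=> // l _; exists (fun=> l).
move=> V /= nV; exists ((fun y : Sigma => y i) @^-1` V); last first.
  apply/seteqP; split=> [l [y Vy <-]//|l Vl]; by exists (fun=> l).
exists i.+1 => y xy /=;
  rewrite (cylinder_eq xy (cylinder_mkseq x i.+1)) ?size_mkseq//.
exact: nbhs_singleton.
Qed.

Lemma symbolic_compact : compact [set: Sigma].
Proof.
have := @tychonoff nat (fun=> discrete_topology A) (fun=> setT).
have fin : compact [set: discrete_topology A].
  by apply: finite_compact; exact: (@finite_finset A setT).
move=> /(_ (fun=> fin)); congr compact.
by apply/seteqP; split.
Qed.

Lemma continuous_letterwise (R : realType) (phi : Sigma -> R) :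
  continuous phi -> letterwise_ucont (phi : (nat -> A) -> R).
Proof.
move=> cphi eps eps0; have e20 : 0 < eps / 2 by lra.
pose small : set (seq A) := [set w | forall x y, cylinder w x -> cylinder w y ->
  `|phi x - phi y| <= eps].
have := symbolic_compact; rewrite compact_cover.
move=> /(_ (seq A) small (fun w => cylinder w)).
have op w : small w -> open (cylinder w : set Sigma).
  by move=> _; have [] := cylinder_clopen w.
have cov : [set: Sigma] `<=` cover small (fun w => cylinder w : set Sigma).
  move=> x _; have /cvgrPdist_lt/(_ _ e20)/nbhs_cylinder[n Hn] := cphi x.
  exists (mkseq x n); last exact: cylinder_mkseq.
  move=> y z /Hn /= Hy /Hn /= Hz.
  have := ler_distD (phi x) (phi y) (phi z).
  by rewrite (distrC (phi y) (phi x)); lra.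
move=> /(_ op cov)[S Ssmall Scov]; exists (\max_(w <- S) size w)%N => x y xy.
have [w wS xw] := Scov x I.
have /set_mem sw := Ssmall w wS; apply: sw => //.
rewrite /cylinder/= -[RHS]xw; apply: eq_cylinder => i iw.
by rewrite xy// (leq_trans iw)// (leq_bigmax_seq w).
Qed.

(** An open set is the union of the countably many cylinders it contains, so
    the clopen sets generate the Borel sets. *)
Lemma open_sigma_clopen : <<s @open Sigma >> = <<s @clopen Sigma >>.
Proof.
apply/seteqP; split; last by apply: sub_sigma_algebra2 => U [].
apply: smallest_sub; first exact: smallest_sigma_algebra.
move=> U oU; have [s0 sC sU] := smallest_sigma_algebra setT (@clopen Sigma).
pose V n : set Sigma := if @choice.unpickle (seq A) n is Some w then
  [set x | cylinder w x /\ cylinder w `<=` U] else set0.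
have -> : U = \bigcup_n V n.
  apply/seteqP; split=> [x Ux|x [n _]]; last first.
    by rewrite /V; case: choice.unpickle => [w [xw]|//]; apply.
  have /nbhs_cylinder[n Hn] : nbhs x U by exact: open_nbhs_nbhs.
  exists (choice.pickle (mkseq x n)) => //; rewrite /V choice.pickleK;
    split=> //.
  exact: cylinder_mkseq.
apply: sU => n; rewrite /V; case: choice.unpickle => [w|//].
have [wU|nwU] := pselect (cylinder w `<=` U).
  rewrite (_ : [set x | _] = cylinder w); last by apply/seteqP; split=> x // [].
  by apply: sub_sigma_algebra; exact: cylinder_clopen.
by rewrite (_ : [set x | _] = set0)//; apply/seteqP; split=> x // [].
Qed.

End SymbolicTopology.

(** * Measures on the symbolic space *)

Section MeasureUniqueness.
Context {R : realType} {d : nat} {a : 'I_d -> nat}.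
Context {D : {set {dffun forall q : 'I_d, 'I_(a q)}}} (D0 : D != finset.set0).

Local Notation Sigma := (symbolic_space D0).
Local Notation Borel := (borel_symbolic_space D0).

Lemma clopen_measurable (B : set Borel) : clopen (B : set Sigma) -> measurable
  B.
Proof. by move=> [oB _]; exact: sub_sigma_algebra. Qed.

Lemma eq_clopen_measure (m1 m2 : {measure set Borel -> \bar R}) :
  (m1 setT < +oo)%E -> (forall B, clopen (B : set Sigma) -> m1 B = m2 B) ->
  forall B, measurable B -> m1 B = m2 B.
Proof.
move=> m1oo m12 B mB;
  apply: (@measure_unique _ R Borel (@clopen Sigma) (fun=> setT)) => //.
- exact: open_sigma_clopen.
- exact: clopenI.
- by move=> _; exact: clopenT.
- by rewrite bigcup_const.
Qed.

Lemma measurable_continuous (f : Sigma -> R) : continuous f ->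
  measurable_fun [set: Borel] f.
Proof.
move=> /continuousP cf; apply: (measurability _ (RGenOpens.measurableE R)).
move=> _ [_ [x [y ->] <-]]; rewrite setTI; apply: sub_sigma_algebra.
exact/cf/interval_open.
Qed.

Lemma shift_clopen (B : set Sigma) : clopen B -> clopen (@Defs.shift _ _ _ D0
  @^-1` B).
Proof.
move=> [oB cB]; have cs : continuous (@Defs.shift _ _ _ D0).
  move=> x U /nbhs_cylinder[n Hn]; have := cylinder_clopen (mkseq x n.+1).
  move=> [oC _]; have : nbhs x (cylinder (mkseq x n.+1)).
    by apply: open_nbhs_nbhs; split=> //; exact: cylinder_mkseq.
  apply: (@filterS _ _ (nbhs_filter (x : Sigma))) => y xy; apply: Hn.
  rewrite /cylinder/= size_mkseq.
  apply: eq_cylinder => i ni; apply/esym.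
  by apply: (cylinder_eq (cylinder_mkseq x n.+1) xy); rewrite size_mkseq.
split; first exact: (open_comp (fun x _ => cs x)).
exact: (closed_comp (fun x _ => cs x)).
Qed.

Lemma measurable_shift : measurable_fun [set: Borel] (@Defs.shift _ _ _ D0 :
  Borel -> Borel).
Proof.
apply: (@measurability _ _ Borel Borel setT _ (@clopen Sigma)
  (open_sigma_clopen D0)) => _ [B cB <-]; rewrite setTI.
by apply: clopen_measurable; exact: shift_clopen.
Qed.

End MeasureUniqueness.

(** The clopen sets form an algebra; the copy of the symbolic space carries it
    as its measurable structure. *)
Section ClopenAlgebra.
Context {d : nat} {a : 'I_d -> nat}.
Context {D : {set {dffun forall q : 'I_d, 'I_(a q)}}}.

Definition clopen_space (D0 : D != finset.set0) : Type := symbolic_space D0.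

Variable D0 : D != finset.set0.

HB.instance Definition _ := Pointed.on (clopen_space D0).

HB.instance Definition _ := isAlgebraOfSets.Build default_measure_display
  (clopen_space D0) (@clopen0 (symbolic_space D0)) (@clopenU (symbolic_space
    D0))
  (fun B cB => @clopenC (symbolic_space D0) B B cB).

End ClopenAlgebra.

Section ClopenContent.
Context {R : realType} {d : nat} {a : 'I_d -> nat}.
Context {D : {set {dffun forall q : 'I_d, 'I_(a q)}}} (D0 : D != finset.set0).

Local Notation Sigma := (symbolic_space D0).
Local Notation Borel := (borel_symbolic_space D0).

Variable m : set Sigma -> R.
Hypotheses (m_ge0 : forall B, 0 <= m B) (mT : m setT = 1).
Hypothesis mU : forall B C, B `&` C = set0 -> m (B `|` C) = m B + m C.

Let m0 : m set0 = 0.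
Proof. by have := mU (setI0 set0); rewrite setU0; lra. Qed.

Let m_bigsetU (F : nat -> set Sigma) n : trivIset setT F ->
  m (\big[setU/set0]_(i < n) F i) = \sum_(i < n) m (F i).
Proof.
move=> tF; elim: n => [|n IHn]; first by rewrite !big_ord0.
rewrite !big_ord_recr/= mU ?IHn//; apply/seteqP; split=> // x [].
rewrite -bigcup_mkord => -[i /= im Fix Fnx].
by have := tF i n I I (ex_intro _ x (conj Fix Fnx)) => E; rewrite E ltnn in im.
Qed.

Definition clopen_content (B : set (clopen_space D0)) : \bar R := (m B)%:E.

Let content0 : clopen_content set0 = 0%E.
Proof. by rewrite /clopen_content m0. Qed.

Let content_ge0 B : (0 <= clopen_content B)%E.
Proof. by rewrite lee_fin. Qed.

(** By compactness, a disjoint union of clopen sets that is clopen has finitely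
    many nonempty terms, so finite additivity implies countable additivity. *)
Let content_sigma_additive : semi_sigma_additive clopen_content.
Proof.
move=> F clF tF [oU cU].
have cptU : compact (\bigcup_n F n : set Sigma).
  by apply: subclosed_compact (@symbolic_compact _ _ _ D0) _.
move: cptU; rewrite compact_cover => /(_ nat setT F (fun i _ => (clF i).1)).
move=> /(_ (fun x Ux => Ux))[S _ Scov].
pose N := (\max_(i <- S) i).+1.
have FN n : (N <= n)%N -> F n = set0.
  move=> Nn; apply/seteqP; split=> // x Fnx.
  have [i iS Fix] : (cover [set` S] F) x by apply: Scov; exists n.
  have E := tF i n I I (ex_intro _ x (conj Fix Fnx)).
  by move: Nn; rewrite -E /N ltnNge (leq_bigmax_seq i).
have UN n : (N <= n)%N -> \bigcup_i F i = \big[setU/set0]_(i < n) F i.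
  move=> Nn; rewrite -bigcup_mkord; apply/seteqP; split=> x [i Ai Fix].
    exists i => //=; rewrite ltnNge; apply/negP => ni.
    by move: Fix; rewrite FN// (leq_trans Nn).
  by exists i.
apply: cvg_near_cst; exists N => // n /= Nn.
by rewrite /clopen_content (UN n Nn) m_bigsetU// big_mkord sumEFin.
Qed.

HB.instance Definition _ := isMeasure.Build _ _ _ clopen_content
  content0 content_ge0 content_sigma_additive.

Definition borel_extension (B : set Borel) : \bar R :=
  measure_extension clopen_content B.

Let extension0 : borel_extension set0 = 0%E.
Proof. exact: measure0. Qed.

Let extension_ge0 B : (0 <= borel_extension B)%E.
Proof. exact: measure_ge0. Qed.

Let extension_sigma_additive : semi_sigma_additive borel_extension.
Proof.
move=> F mF tF mUF.
apply: (measure_semi_sigma_additive (s := measure_extension clopen_content))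
  => //.
  by move=> i; have := mF i; rewrite /measurable/= open_sigma_clopen.
by move: mUF; rewrite /measurable/= open_sigma_clopen.
Qed.

HB.instance Definition _ := isMeasure.Build _ _ _ borel_extension
  extension0 extension_ge0 extension_sigma_additive.

Let extension_clopen (B : set Sigma) : clopen B -> borel_extension B = (m B)%:E.
Proof. by move=> cB; exact: (measurable_mu_extE clopen_content). Qed.

Let extensionT : borel_extension setT = 1%E.
Proof. by rewrite extension_clopen ?mT//; exact: clopenT. Qed.

HB.instance Definition _ := Measure_isProbability.Build _ _ _ borel_extension
  extensionT.

Lemma clopen_content_extension : exists mu : probability Borel R,
  forall B : set Sigma, clopen B -> mu B = (m B)%:E.
Proof. by exists borel_extension. Qed.

End ClopenContent.

Section IntegralSet.
Context {R : realType} {d : nat} {a : 'I_d -> nat}.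
Context {D : {set {dffun forall q : 'I_d, 'I_(a q)}}} (D0 : D != finset.set0).

Local Notation A := (alphabet D0).
Local Notation Sigma := (symbolic_space D0).
Local Notation Borel := (borel_symbolic_space D0).
Local Notation sigma := (@Defs.shift _ _ _ D0).

Lemma integrable_bounded (mu : probability Borel R) (f : Sigma -> R) E :
  measurable_fun [set: Borel] f -> (forall x, `|f x| <= E) ->
  mu.-integrable [set: Borel] (EFin \o f).
Proof.
move=> mf fE; apply: measurable_bounded_integrable => //.
  by rewrite /= probability_setT ltry.
exists E; split; first exact: num_real.
by move=> M EM x _; exact: le_trans (fE x) (ltW EM).
Qed.

Lemma le_normr_Rintegral_cst (mu : probability Borel R) (f : Sigma -> R) E :
  measurable_fun [set: Borel] f -> (forall x, `|f x| <= E) ->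
  `|(\int[mu]_x f x)%R| <= E.
Proof.
move=> mf fE; have intf := integrable_bounded mu mf fE.
apply: le_trans (le_normr_Rintegral _ intf) _ => //.
have -> : E = (\int[mu]_x E)%R by rewrite Rintegral_cst//= probability_setT
  mulr1.
apply: le_Rintegral => //.
  have := integrable_bounded mu (f := fun x => `|f x|) (E := E); apply.
    by apply: measurableT_comp mf; exact: normr_measurable.
  by move=> x; rewrite normr_id.
have := integrable_bounded mu (f := fun=> E) (E := `|E|); apply.
  exact: measurable_cst.
by [].
Qed.

Lemma Rintegral_shift (mu : probability Borel R) (f : Sigma -> R) E :
  shift_invariant mu -> measurable_fun [set: Borel] f -> (forall x, `|f x| <=
    E) ->
  (\int[mu]_x f (sigma x) = \int[mu]_x f x)%R.
Proof.
move=> inv mf fE; congr fine.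
have intf : mu.-integrable [set: Borel] (EFin \o (f \o sigma)).
  apply: (@integrable_bounded _ _ E); last by move=> x; exact: fE.
  by apply: measurableT_comp mf _; exact: measurable_shift.
have := @integral_pushforward _ _ Borel Borel R sigma (@measurable_shift _ _ _
  D0) mu setT
  (EFin \o f) _ intf measurableT.
move=> <-; last exact/measurable_EFinP.
apply: eq_measure_integral => [|ms B mB _]; first exact: measurable_shift.
exact: inv.
Qed.

(** The points interpolating between [x] and [y] letter by letter have Birkhoff
    sums that vary slowly, so one of them is nearly zero when the sums of [x]
    and [y] have opposite signs. *)
Lemma deviation_ivt (phi : Sigma -> R) alpha eps :
  letterwise_ucont (phi : (nat -> A) -> R) -> 0 < eps ->
  exists C, forall m (x y : Sigma), -1 <= deviation phi alpha m x ->
    deviation phi alpha m y <= 1 ->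
    exists z, `|deviation phi alpha m z| <= eps * m%:R + C.
Proof.
move=> uc eps0; have [C C0 HC] := deviation_cylinder uc alpha eps0.
have [E E0 HE] := potential_bounded uc alpha.
exists (C + 2 * E + 1) => m x y xm ym.
pose z j : nat -> A := fun i => if (i < j)%N then y i else x i.
pose v j := deviation phi alpha m (z j).
have step j : (j < m)%N -> `|v j - v j.+1| <= eps * m%:R + C + 2 * E.
  move=> jm; rewrite /v.
  have [k Em] : exists k, m = (j + (1 + k))%N.
    by exists (m - j.+1)%N; rewrite addnA addn1 subnKC.
  rewrite Em !deviationD.
  have -> : tail 1 (tail j (z j.+1)) = tail 1 (tail j (z j)).
    apply/funext => i; rewrite /tail /z ifN ?ifN//; lia.
  have := HC j (z j) (z j.+1) ltac:(move=> i ij; rewrite /z ij leqW//).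
  have := deviation_le 1 (tail j (z j)) HE.
  have := deviation_le 1 (tail j (z j.+1)) HE.
  set p := deviation _ _ j _; set p' := deviation _ _ j _.
  set q := deviation _ _ 1 _; set q' := deviation _ _ 1 _;
    set r := deviation _ _ k _.
  rewrite !natrD => hq' hq hp.
  have -> : p + (q' + r) - (p' + (q + r)) = (p - p') + (q' - q) by ring.
  apply: le_trans (ler_normD _ _) _; have := ler_normB q' q.
  have : 0 <= eps * k%:R by rewrite mulr_ge0// ltW.
  lra.
(* Were all sums far from 0, none of the steps could change their sign. *)
have B0 : 0 <= eps * m%:R + C + 2 * E by rewrite !addr_ge0// ?mulr_ge0 ?(ltW
  eps0)// mulr_ge0.
apply: contrapT => /forallNP nz.
have far j : eps * m%:R + C + 2 * E + 1 < `|v j|.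
  by have /negP := nz (z j); rewrite -ltNge !addrA.
have pos j : (j <= m)%N -> eps * m%:R + C + 2 * E + 1 < v j.
  elim: j => [|j IHj] jm.
    have := far 0%N; have -> : v 0%N = deviation phi alpha m x by [].
    rewrite ltr_normr => /orP[//|]; lra.
  have := IHj (ltnW jm); have := step j jm; have := far j.+1.
  rewrite ltr_normr ler_norml => /orP[//|? /andP[? ?] ?]; lra.
have := pos m (leqnn m); rewrite /v => vm.
have := HC m (z m) y ltac:(by move=> i im; rewrite /z im).
rewrite ler_norml => /andP[_ ?]; lra.
Qed.

(** By invariance the centred Birkhoff sums have integral 0, so they take values
    on both sides of 0, up to any error. *)
Lemma integral_set_attainable (phi : Sigma -> R) alpha : continuous phi ->
  integral_set phi alpha -> attainable phi alpha.
Proof.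
move=> cphi [mu inv Ialpha]; have uc := continuous_letterwise cphi.
have [E E0 HE] := potential_bounded uc alpha.
have mphi : measurable_fun [set: Borel] (fun x => phi x - alpha).
  by apply: measurable_funB;
    [exact: measurable_continuous|exact: measurable_cst].
have mtail l : measurable_fun [set: Borel] (tail l : Borel -> Borel).
  elim: l => [|l IHl]; first exact: measurable_id.
  have -> : tail l.+1 = tail l \o sigma :> (Borel -> Borel) by apply/funext.
  by apply: measurableT_comp IHl _; exact: measurable_shift.
have mdev m : measurable_fun [set: Borel] (deviation phi alpha m).
  by apply: measurable_sum => l; apply: measurableT_comp mphi (mtail l).
have int_cst r : mu.-integrable [set: Borel] (EFin \o (fun=> r)).
  by apply: (integrable_bounded mu (f := fun=> r) (E := `|r|)) => //;
    exact: measurable_cst.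
have int_phi : mu.-integrable [set: Borel] (EFin \o phi).
  have [Ephi _ HEphi] := potential_bounded uc 0.
  apply: (integrable_bounded mu (measurable_continuous cphi) (E := Ephi)) => x.
  by have := HEphi x; rewrite subr0.
have dev_int m : (\int[mu]_x deviation phi alpha m x = 0)%R.
  have term l : (\int[mu]_x (phi (tail l x) - alpha) = 0)%R.
    elim: l => [|l IHl].
      by rewrite RintegralB// Rintegral_cst//= probability_setT mulr1 -Ialpha
        subrr.
    rewrite -IHl -(Rintegral_shift (f := fun x =>
      phi (tail l x) - alpha) (E := E))//.
    exact: measurableT_comp mphi (mtail l).
  elim: m => [|m IHm].
    by rewrite /deviation; under eq_Rintegral do rewrite big_ord0;
      rewrite Rintegral_cst// mul0r.
  under eq_Rintegral do rewrite /deviation big_ord_recr/=.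
  rewrite RintegralD//; first by rewrite term addr0; exact: IHm.
    apply: (integrable_bounded mu (mdev m) (E := m%:R * E)) => x.
    exact: deviation_le.
  apply: (integrable_bounded mu (f := fun x =>
    phi (tail m x) - alpha) (E := E)) => //.
  exact: measurableT_comp mphi (mtail m).
have int_dev m : mu.-integrable [set: Borel] (EFin \o deviation phi alpha m).
  by apply: (integrable_bounded mu (mdev m) (E := m%:R * E)) => x;
    exact: deviation_le.
move=> eps eps0 M; have e20 : 0 < eps / 2 by lra.
have [C HC] := deviation_ivt alpha uc e20.
have [N HN] := natr_large C e20; exists (M + N)%N; first exact: leq_addr.
set m := (M + N)%N.
have [x xm] : exists x : Sigma, -1 <= deviation phi alpha m x.
  apply: contrapT => /forallNP H.
  have : (\int[mu]_x deviation phi alpha m x <= \int[mu]_(x in [set: Borel])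
    -1)%R.
    by apply: le_Rintegral => // t _; rewrite ltW// ltNge; apply/negP; exact: H.
  by rewrite dev_int Rintegral_cst//= probability_setT mulr1; lra.
have [y ym] : exists y : Sigma, deviation phi alpha m y <= 1.
  apply: contrapT => /forallNP H.
  have : (\int[mu]_(_ in [set: Borel]) 1 <= \int[mu]_t deviation phi alpha m
    t)%R.
    by apply: le_Rintegral => // t _; rewrite ltW// ltNge; apply/negP; exact: H.
  by rewrite dev_int Rintegral_cst//= probability_setT mulr1; lra.
have [z zm] := HC m x y xm ym; exists z; apply: le_trans zm _.
by have := HN m (leq_addl _ _); lra.
Qed.

End IntegralSet.

(** * Limits of empirical measures *)

Lemma fmap_ultra (S T : Type) (f : S -> T) (U : set_system S) :
  UltraFilter U -> UltraFilter (f @ U).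
Proof.
move=> UU; have PU : ProperFilter U by exact: ultra_proper.
split=> [|G PG fG]; first exact: fmap_proper_filter.
apply/seteqP; split=> // B GB;
  have [//|UnB] := in_ultra_setVsetC (f @^-1` B) UU.
have GnB : G (~` B) by apply: fG.
by have /filter_ex[x []] : G (B `&` ~` B) by exact: filterI.
Qed.

(** Along an ultrafilter, bounded averaging functionals converge on all bounded
    functions simultaneously, without passing to subsequences. *)
Section UltraMean.
Context {R : realType} {X : Type} (U : set_system nat) (avg : nat -> (X -> R)
  -> R).
Hypothesis U_ultra : UltraFilter U.
Hypothesis avg_linear : forall k c f g,
  avg k (fun x => c * f x + g x) = c * avg k f + avg k g.
Hypothesis avg_bounded : forall k f E, (forall x, `|f x| <= E) -> `|avg k f|
  <= E.

Let U_proper : ProperFilter U. Proof. exact: ultra_proper. Qed.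

Definition ultra_mean f : R := lim (avg ^~ f @ U).

Lemma ultra_mean_cvg f E : (forall x, `|f x| <= E) -> avg ^~ f @ U -->
  ultra_mean f.
Proof.
move=> fE; have := @segment_compact R (- E) E; rewrite compact_ultra.
have inE : (avg ^~ f @ U) `[- E, E]%classic.
  by apply: nearW => k; rewrite /= in_itv/= -ler_norml avg_bounded.
move=> /(_ _ (fmap_ultra _ U_ultra) inE)[l [_ ul]].
by rewrite /ultra_mean (cvg_lim _ ul).
Qed.

Lemma ultra_mean_eq f l : avg ^~ f @ U --> l -> ultra_mean f = l.
Proof. by move=> ul; exact: cvg_lim. Qed.

Lemma ultra_mean_linear c f g E E' :
  (forall x, `|f x| <= E) -> (forall x, `|g x| <= E') ->
  ultra_mean (fun x => c * f x + g x) = c * ultra_mean f + ultra_mean g.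
Proof.
move=> fE gE; apply: ultra_mean_eq; under eq_cvg do rewrite avg_linear.
by apply: cvgD; [apply: cvgMl_tmp;
  exact: ultra_mean_cvg fE|exact: ultra_mean_cvg gE].
Qed.

Lemma ultra_mean_bounded f E : (forall x, `|f x| <= E) -> `|ultra_mean f| <= E.
Proof.
move=> fE; have cvgf := ultra_mean_cvg fE.
rewrite ler_norml; apply/andP; split.
  by apply: (cvgr_to_ge cvgf); apply: nearW => k; have := avg_bounded k fE;
    rewrite ler_norml => /andP[].
by apply: (cvgr_to_le cvgf); apply: nearW => k; have := avg_bounded k fE;
  rewrite ler_norml => /andP[].
Qed.

End UltraMean.

Section EmpiricalLimit.
Context {R : realType} {d : nat} {a : 'I_d -> nat}.
Context {D : {set {dffun forall q : 'I_d, 'I_(a q)}}} (D0 : D != finset.set0).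

Local Notation A := (alphabet D0).
Local Notation Sigma := (symbolic_space D0).
Local Notation Borel := (borel_symbolic_space D0).
Local Notation sigma := (@Defs.shift _ _ _ D0).

Lemma measurable_cylinder_sum (s : seq (seq A)) (c : seq A -> R) :
  measurable_fun [set: Borel] (fun x : Borel =>
    \sum_(w <- s) c w * \1_(cylinder w) x).
Proof.
apply: measurable_sum => w; apply: measurable_funM; first exact: measurable_cst.
by apply: measurable_indic; apply: clopen_measurable; exact: cylinder_clopen.
Qed.

Lemma cylinder_sum_bounded (s : seq (seq A)) (c : seq A -> R) (x : Sigma) :
  `|\sum_(w <- s) c w * \1_(cylinder w) x| <= \sum_(w <- s) `|c w|.
Proof.
apply: le_trans (ler_norm_sum _ _ _) _; apply: ler_sum => w _.
by rewrite normrM ler_piMr// ger0_norm// indicE; case: (_ \in _).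
Qed.

Lemma cylinder_sum_approx (phi : Sigma -> R) eps :
  letterwise_ucont (phi : (nat -> A) -> R) -> 0 < eps -> exists s c,
  forall x, `|phi x - \sum_(w <- s) c w * \1_(cylinder w) x| <= eps.
Proof.
move=> uc eps0; have [K HK] := uc _ eps0.
have l0 : A := point.
exists (words K), (fun w => phi (prepend w (fun=> l0))) => x.
have -> : \sum_(w <- words K) phi (prepend w (fun=> l0)) * \1_(cylinder w) x
    = phi (prepend (mkseq x K) (fun=> l0)).
  have xK : mkseq x K \in words (A := A) K by rewrite mem_words size_mkseq.
  have uK : uniq (words (A := A) K) by rewrite map_inj_uniq ?enum_uniq//;
    exact: val_inj.
  rewrite (bigD1_seq _ xK uK)/= indicE mem_set ?mulr1;
    last exact: cylinder_mkseq.
  rewrite big_seq_cond big1 ?addr0// => w /andP[];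
    rewrite mem_words => /eqP wK nw.
  rewrite indicE memNset ?mulr0// => xw; move/eqP: nw; apply.
  by rewrite -xw wK.
apply: HK => i iK; apply: (@cylinder_eq _ (mkseq x K)); rewrite ?size_mkseq//.
  exact: cylinder_mkseq.
exact: cylinder_prepend.
Qed.

(** The empirical measures along the orbit pieces that realize [alpha] have a
    limit along an ultrafilter, which is an invariant mean; on clopen sets it
    is a content, and it extends to an invariant measure. *)
Lemma attainable_integral_set (phi : Sigma -> R) alpha : continuous phi ->
  attainable phi alpha -> integral_set phi alpha.
Proof.
move=> cphi att; have uc := continuous_letterwise cphi.
have /choice[mx Hmx] (k : nat) : exists mx : nat * Sigma, (k < mx.1)%N /\
    `|deviation phi alpha mx.1 mx.2| <= k.+1%:R^-1 * mx.1%:R.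
  have k0 : 0 < k.+1%:R^-1 :> R by rewrite invr_gt0.
  by have [m km [x Hx]] := att _ k0 k.+1; exists (m, x).
pose avg k (f : Sigma -> R) := (mx k).1%:R^-1 * \sum_(l < (mx k).1) f (tail l
  (mx k).2).
have mx0 k : 0 < (mx k).1%:R :> R.
  by have [km _] := Hmx k; rewrite ltr0n (leq_ltn_trans _ km).
have [U [U_ultra U_oo]] := ultraFilterLemma eventually_filter.
have U_proper : ProperFilter U by exact: ultra_proper.
have avg_linear k c f g : avg k (fun x =>
  c * f x + g x) = c * avg k f + avg k g.
  by rewrite /avg big_split/= -mulr_sumr mulrDr mulrCA.
have avg_bounded k f E : (forall x, `|f x| <= E) -> `|avg k f| <= E.
  move=> fE; rewrite normrM normfV (gtr0_norm (mx0 k)) ler_pdivrMl//.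
  apply: le_trans (ler_norm_sum _ _ _) _.
  apply: le_trans (ler_sum _ (fun l _ => fE _)) _.
  by rewrite sumr_const card_ord mulr_natl.
pose mean := ultra_mean U avg.
have mean_linear := ultra_mean_linear U_ultra avg_linear avg_bounded.
have mean_bounded := ultra_mean_bounded U_ultra avg_bounded.
have indic_le1 (B : set Sigma) x : `|\1_B x : R| <= 1.
  by rewrite indicE; case: (_ \in _); rewrite ?normr1 ?normr0.
have mean_ge0 (B : set Sigma) : 0 <= mean (\1_B).
  apply: (cvgr_to_ge (ultra_mean_cvg U_ultra avg_bounded (indic_le1 B))).
  apply: nearW => k; apply: mulr_ge0; first by rewrite invr_ge0 ltW.
  by apply: sumr_ge0 => l _; rewrite indicE.
have mean_eq f l : avg ^~ f @ U --> l -> mean f = l by exact: ultra_mean_eq.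
have meanT : mean (\1_setT) = 1.
  apply: mean_eq; apply: cvg_near_cst; apply: nearW => k.
  rewrite /avg (eq_bigr (fun=> 1)); last by move=> l _; rewrite indicT.
  by rewrite sumr_const card_ord mulVf// gt_eqF.
have meanU (B C : set Sigma) : B `&` C = set0 ->
    mean (\1_(B `|` C)) = mean (\1_B) + mean (\1_C).
  move=> BC; rewrite -[X in _ = X + _]mul1r -(mean_linear _ _ _ _ _ (indic_le1
    B) (indic_le1 C)).
  congr mean; apply/funext => x; rewrite mul1r !indicE in_setU.
  have [xB|xB] := boolP (x \in B); have [xC|xC] := boolP (x \in C);
    rewrite /= ?addr0 ?add0r//.
  suff : (B `&` C) x by rewrite BC.
  by split; exact: set_mem.
have [mu Hmu] := clopen_content_extension mean_ge0 meanT meanU.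
have mean_shift f E : (forall x, `|f x| <= E) -> mean (f \o sigma) = mean f.
  move=> fE; apply: mean_eq.
  have cvg0 : (fun k => avg k (f \o sigma) - avg k f) @ U --> (0 : R).
    apply: (cvg_trans (G := (fun k => avg k (f \o sigma) - avg k f) @ \oo)).
      by move=> V /= VU; exact: U_oo.
    apply/cvgrPdist_le => e e0.
    have [N HN] := natr_large (2 * E) e0; exists N => // k /= Nk.
    rewrite sub0r normrN /avg -mulrBr -sumrB.
    have telescope m (x : Sigma) :
        \sum_(l < m) ((f \o sigma) (tail l x) - f (tail l x)) = f (tail m x) -
          f x.
      rewrite -(big_mkord xpredT (fun l =>
        f (sigma (tail l x)) - f (tail l x))).
      rewrite (telescope_sumr_eq (fun l => f (tail l x)))// => l _.
      congr (f _ - _); apply/funext => i; rewrite /tail /Defs.shift.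
      by rewrite addSnnS.
    rewrite telescope normrM normfV (gtr0_norm (mx0 k)) ler_pdivrMl//.
    apply: le_trans (ler_normB _ _) _.
    have := fE (tail (mx k).1 (mx k).2); have := fE (mx k).2.
    have := HN (mx k).1 ltac:(have [/ltnW km _] := Hmx k; exact: leq_trans km).
    lra.
  have : avg k (f \o sigma) - avg k f + avg k f @[k --> U] --> 0 + mean f.
    by apply: cvgD => //; exact: ultra_mean_cvg fE.
  by rewrite add0r; under eq_cvg do rewrite /= subrK.
have inv : shift_invariant mu.
  move=> B mB.
  have -> : mu (sigma @^-1` B) = pushforward mu (sigma : Borel -> Borel) B by
    [].
  apply: eq_clopen_measure mB => [|ms|ms C cC]; first exact: measurable_shift.
    suff : (mu [set: Borel] < +oo)%E by [].
    by rewrite probability_setT ltry.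
  transitivity (mean (\1_(sigma @^-1` C)))%:E.
    exact: (Hmu _ (shift_clopen cC)).
  transitivity (mean (\1_C))%:E; last by apply/esym; exact: (Hmu _ cC).
  by congr (_%:E); exact: (mean_shift _ _ (indic_le1 C)).
exists mu => //.
have int_sum s c : (\int[mu]_x \sum_(w <- s) c w * \1_(cylinder w) x)%R
    = mean (fun x => \sum_(w <- s) c w * \1_(cylinder w) x).
  elim: s => [|w s IHs].
    under eq_Rintegral do rewrite big_nil; rewrite Rintegral_cst// mul0r.
    apply/esym; apply: mean_eq; apply: cvg_near_cst; apply: nearW => k.
    by rewrite /avg big1 ?mulr0// => l _; rewrite big_nil.
  under eq_Rintegral do rewrite big_cons.
  have mw : measurable (cylinder w : set Borel).
    by apply: clopen_measurable; exact: cylinder_clopen.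
  have int1 : mu.-integrable [set: Borel] (EFin \o (\1_(cylinder w) : Borel ->
    R)).
    apply: (integrable_bounded mu (f := \1_(cylinder w)) (E := 1)).
      exact: measurable_indic.
    exact: indic_le1.
  rewrite RintegralD//.
  - rewrite RintegralZl// IHs.
    have -> : (\int[mu]_x \1_(cylinder w) x)%R = mean (\1_(cylinder w)).
      rewrite /Rintegral integral_indic// setIT.
      by rewrite [X in fine X]Hmu//; exact: cylinder_clopen.
    rewrite -(mean_linear _ _ _ _ _ (indic_le1 _) (cylinder_sum_bounded s c)).
    by congr mean; apply/funext => x; rewrite big_cons.
  - apply: (integrable_bounded mu (f := fun x =>
    c w * \1_(cylinder w) x) (E := `|c w|)).
      by apply: measurable_funM;
        [exact: measurable_cst|exact: measurable_indic].
    by move=> x; rewrite normrM ler_piMr.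
  - apply: (integrable_bounded mu (measurable_cylinder_sum s c)).
    exact: cylinder_sum_bounded.
have mean_phi : mean phi = alpha.
  apply: mean_eq; apply: (cvg_trans (G := avg ^~ phi @ \oo)).
    by move=> V /= VU; exact: U_oo.
  apply/cvgrPdist_le => e e0.
  have [N HN] := natr_large 1 e0; exists N => // k /= Nk.
  have -> : alpha - avg k phi = - ((mx k).1%:R^-1 * deviation phi alpha (mx
    k).1 (mx k).2).
    rewrite /deviation sumrB sumr_const card_ord -[alpha *+ _]mulr_natl mulrBr.
    by rewrite mulKf ?gt_eqF// opprB.
  rewrite normrN normrM normfV (gtr0_norm (mx0 k)) ler_pdivrMl//.
  have [_ /le_trans] := Hmx k; apply; rewrite mulrC ler_pM2l//.
  rewrite -[leLHS]mul1r ler_pdivrMr ?ltr0n//; apply: HN.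
  exact: leq_trans Nk (leqnSn k).
apply/eqP; rewrite -subr_eq0 -normr_le0; apply/ler_addgt0Pr => e e0;
  rewrite add0r.
have e20 : 0 < e / 2 by lra.
have [s [c Hsc]] := cylinder_sum_approx uc e20.
pose psi := fun x : Sigma => \sum_(w <- s) c w * \1_(cylinder w) x.
have [E E0 HE] := potential_bounded uc 0.
have phiE x : `|phi x| <= E by have := HE x; rewrite subr0.
have psiE := cylinder_sum_bounded s c.
have mphi := measurable_continuous cphi.
have mpsi := measurable_cylinder_sum s c.
have close1 : `|(\int[mu]_x phi x)%R - (\int[mu]_x psi x)%R| <= e / 2.
  rewrite -RintegralB//.
  - apply: (le_normr_Rintegral_cst mu (f := fun x => phi x - psi x)) => //.
    exact: measurable_funB.
  - exact: (integrable_bounded mu mphi phiE).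
  - exact: (integrable_bounded mu mpsi psiE).
have close2 : `|mean psi - mean phi| <= e / 2.
  have -> : mean psi - mean phi = mean (fun x => -1 * phi x + psi x).
    have -> : mean (fun x => -1 * phi x + psi x) = -1 * mean phi + mean psi.
      exact: (mean_linear _ _ _ _ _ phiE psiE).
    by rewrite mulN1r addrC.
  by apply: mean_bounded => x; rewrite mulN1r addrC distrC.
rewrite /psi int_sum in close1; rewrite mean_phi in close2.
have := ler_distD (mean psi) (\int[mu]_x phi x)%R alpha.
by rewrite -/psi in close1; lra.
Qed.

End EmpiricalLimit.

(** * The packing spectrum *)

Section PackingSpectrum.
Context {R : realType} {d : nat} {a : 'I_d -> nat}.
Context {D : {set {dffun forall q : 'I_d, 'I_(a q)}}} (D0 : D != finset.set0).
Hypothesis d_gt0 : (0 < d)%N.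
Hypothesis a_decr : forall p q : 'I_d, (p < q)%N -> (a q < a p)%N.
Hypothesis a_ge2 : forall q : 'I_d, (2 <= a q)%N.

Local Notation A := (alphabet D0).
Local Notation Sigma := (symbolic_space D0).

Variable phi : Sigma -> R.
Hypothesis phi_cont : continuous phi.

Let phi_uc : letterwise_ucont (phi : (nat -> A) -> R).
Proof. exact: continuous_letterwise. Qed.

Let A_gt0 : (0 < #|{: A}|)%N.
Proof. by apply/card_gt0P; exists point. Qed.

Lemma integral_setE : integral_set phi = attainable (phi : (nat -> A) -> R).
Proof.
apply/seteqP; split=> alpha; first exact: integral_set_attainable.
exact: attainable_integral_set.
Qed.

Let integral_set_nonempty : integral_set phi !=set0.
Proof. by rewrite integral_setE; exists (phi (fun=> point));
  exact: attainable_const. Qed.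

Let integral_set_bounds : has_lbound (integral_set phi) /\ has_ubound
  (integral_set phi).
Proof.
have [E HE] := attainable_bounded phi_uc.
by split; [exists (- E)|exists E] => alpha; rewrite integral_setE => /HE;
  rewrite ler_norml => /andP[].
Qed.

Lemma integral_set_itv : integral_set phi = [set` `[alpha_min phi, alpha_max
  phi]].
Proof.
have [hl hu] := integral_set_bounds.
apply/seteqP; split=> alpha.
  by move=> Ia; rewrite /= in_itv/= ge_inf// ub_le_sup.
rewrite /= in_itv/= => /andP[la au].
have att_min : attainable (phi : (nat -> A) -> R) (alpha_min phi).
  apply: attainable_closed => e e0.
  have [b Ib bl] := inf_adherent e0 (conj integral_set_nonempty hl).
  exists b; last by rewrite -integral_setE.
  rewrite ger0_norm; first by rewrite lerBlDl ltW.
  by rewrite subr_ge0 ge_inf.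
have att_max : attainable (phi : (nat -> A) -> R) (alpha_max phi).
  apply: attainable_closed => e e0.
  have [b Ib bu] := sup_adherent e0 (conj integral_set_nonempty hu).
  exists b; last by rewrite -integral_setE.
  rewrite ler0_norm; first by rewrite opprB lerBlDr -lerBlDl ltW.
  by rewrite subr_le0 ub_le_sup.
rewrite integral_setE.
have [E|ne] := eqVneq (alpha_min phi) (alpha_max phi).
  by rewrite (_ : alpha = alpha_min phi)//; apply/eqP; rewrite eq_le la E au.
have lt : 0 < alpha_max phi - alpha_min phi.
  by rewrite subr_gt0 lt_neqAle ne (le_trans la).
pose t := (alpha_max phi - alpha) / (alpha_max phi - alpha_min phi).
have -> : alpha = t * alpha_min phi + (1 - t) * alpha_max phi.
  have : t * (alpha_max phi - alpha_min phi) = alpha_max phi - alpha.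
    by rewrite /t divfK// gt_eqF.
  lra.
apply: attainable_mix => //; apply/andP; split.
  by rewrite divr_ge0 ?(ltW lt)// subr_ge0.
by rewrite ler_pdivrMr// mul1r lerD2l lerN2.
Qed.

Let birkhoff_levelE alpha :
  birkhoff_level_set phi alpha = birkhoff_level (phi : (nat -> A) -> R) alpha.
Proof.
have iterE l (x : Sigma) : iter l (@Defs.shift _ _ _ D0) x = tail l x.
  elim: l => [//|l IHl]; apply/funext => i /=.
  by rewrite IHl /Defs.shift /tail addSnnS.
have devE n (x : Sigma) : n%:R * (n%:R^-1 * \sum_(l < n) phi (iter l
  (@Defs.shift _ _ _ D0) x) - alpha)
    = deviation (phi : (nat -> A) -> R) alpha n x.
  case: n => [|n]; first by rewrite mul0r deviation0.
  rewrite mulrBr mulVKf ?pnatr_eq0// /deviation sumrB sumr_const card_ord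
    mulr_natl.
  by congr (_ - _); apply: eq_bigr => l _; rewrite iterE.
apply/seteqP; split=> x.
  move=> /cvgrPdist_le H e e0; have [N _ HN] := H e e0; exists N => n Nn.
  rewrite -devE normrM normr_nat [leRHS]mulrC ler_wpM2l// distrC.
  exact: HN.
move=> H; apply/cvgrPdist_le => e e0; have [N HN] := H e e0.
exists N.+1 => // n /= Nn;
  have n0 : 0 < n%:R :> R by rewrite ltr0n (leq_ltn_trans _ Nn).
rewrite distrC -(ler_pM2l n0) -{1}(normr_nat R n) -normrM devE mulrC.
by apply: HN; exact: ltnW.
Qed.

(** The average over each strip has to be close to [alpha], but this is the only
    link between the strips. So each of them contributes the entropy of its own
    projection, weighted by the proportion of its length to the logarithm of
    the scale. *)
Lemma packing_spectrumE alpha : integral_set phi alpha ->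
  packing_spectrum phi alpha
    = (spectrum (phi : (nat -> A) -> R) (forget_below (D0 := D0))
        (strip_weight (R := R) (a := a)) alpha)%:E.
Proof.
rewrite integral_setE => att; rewrite /packing_spectrum birkhoff_levelE.
have weight_gt0 q : 0 < strip_weight (R := R) (a := a) q by exact:
  strip_weight_gt0.
have length_weight n q := strip_length_weight (R := R) a_decr a_ge2 n q.
apply: (packing_dim_codes (X := nat -> A) (fun=> point)
  (cd := code_at (forget_below (D0 := D0)) (strip_length (R := R) (a := a)))
  (col := cell_colour (R := R) (D0 := D0))
  (kappa := d%:R) (u := (\sum_j a j).+1%:R^-1)).
- by rewrite ltr0n.
- by rewrite invr_gt0 ltr0n.
- by move=> n x y; exact: coding_map_close.
- by move=> n x y; exact: coding_map_sep.
- apply: sumr_ge0 => q _; rewrite mulr_ge0 ?level_entropy_ge0//.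
  exact: ltW.
- by move=> t; exact: birkhoff_level_cover.
- by move=> t F; exact: birkhoff_level_not_covered.
Qed.

Let attainable_conv t alpha beta : 0 <= t <= 1 ->
  integral_set phi alpha -> integral_set phi beta ->
  integral_set phi (t * alpha + (1 - t) * beta).
Proof. by rewrite integral_setE; exact: attainable_mix. Qed.

Lemma packing_spectrum_concave t alpha beta : 0 <= t <= 1 ->
  integral_set phi alpha -> integral_set phi beta ->
  t * fine (packing_spectrum phi alpha) + (1 - t) * fine (packing_spectrum phi
    beta)
    <= fine (packing_spectrum phi (t * alpha + (1 - t) * beta)).
Proof.
move=> t01 Ia Ib; have Iab := attainable_conv t01 Ia Ib.
rewrite !packing_spectrumE//= /spectrum !mulr_sumr -big_split/=.
apply: ler_sum => q _; rewrite integral_setE in Ia Ib Iab.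
rewrite !(mulrCA _ (strip_weight q)) -mulrDr ler_wpM2l//.
  by rewrite ltW// strip_weight_gt0.
exact: level_entropy_concave.
Qed.

Lemma packing_spectrum_continuous :
  {within integral_set phi, continuous (fun alpha =>
    fine (packing_spectrum phi alpha))}.
Proof.
apply: concave_usc_continuous => [alpha Ia|t x y|alpha h Ia ah].
- rewrite packing_spectrumE//=; apply: sumr_ge0 => q _.
  rewrite mulr_ge0 ?level_entropy_ge0//;
    first by rewrite ltW// strip_weight_gt0.
  by rewrite -integral_setE.
- exact: packing_spectrum_concave.
have att : attainable (phi : (nat -> A) -> R) alpha by rewrite -integral_setE.
pose c q := strip_weight (R := R) (a := a) q.
have c0 q : 0 < c q by exact: strip_weight_gt0.
pose S := \sum_(q < d) c q.
have S0 : 0 <= S by apply: sumr_ge0 => q _; exact: ltW.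
pose H q := level_entropy (phi : (nat -> A) -> R) (forget_below (D0 := D0) q).
move: ah; rewrite packing_spectrumE//= /spectrum => ah.
pose e := (h - \sum_(q < d) c q * H q alpha) / (S + 1).
have e0 : 0 < e by rewrite divr_gt0 ?subr_gt0//; lra.
have /choice[dq Hdq] q : exists dq : R, 0 < dq /\ forall beta,
    attainable (phi : (nat -> A) -> R) beta -> `|beta - alpha| <= dq ->
    H q beta <= H q alpha + e.
  have [dq dq0 Hdq] := level_entropy_usc (chi := forget_below (D0 := D0) q)
    A_gt0 att
    (h := H q alpha + e) ltac:(by rewrite ltrDl).
  by exists dq.
have dq0 q : 0 < dq q by have [] := Hdq q.
exists (\big[Num.min/1]_(q < d) dq q); first by apply: lt_bigmin => [|q _];
  [exact: ltr01|].
move=> beta Ib ab; rewrite packing_spectrumE//=.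
apply: (@le_trans _ _ (\sum_(q < d) c q * (H q alpha + e))).
  apply: ler_sum => q _; rewrite ler_wpM2l ?(ltW (c0 q))//.
  have [_] := Hdq q; apply; first by rewrite -integral_setE.
  by apply: le_trans ab _; exact: bigmin_le.
rewrite (eq_bigr _ (fun q _ => mulrDr _ _ _)) big_split/= -mulr_suml -/S.
have : e * (S + 1) = h - \sum_(q < d) c q * H q alpha by rewrite /e divfK//;
  lra.
lra.
Qed.

End PackingSpectrum.

Theorem corollary1 (R : realType) (d : nat) (d_gt0 : (0 < d)%N)
    (a : 'I_d -> nat)
    (a_decr : forall p q : 'I_d, (p < q)%N -> (a q < a p)%N)
    (a_ge2 : forall q : 'I_d, (2 <= a q)%N)
    (D : {set {dffun forall q : 'I_d, 'I_(a q)}}) (D0 : D != finset.set0)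
    (phi : symbolic_space D0 -> R) (phi_cont : continuous phi)
    (phi_ncoh : ~ cohomologous_to_constant phi) :
  [/\ integral_set phi = [set` `[alpha_min phi, alpha_max phi]],
      forall alpha, integral_set phi alpha ->
        packing_spectrum phi alpha \is a fin_num,
      concave_function (integral_set phi)
        (fun alpha => fine (packing_spectrum phi alpha)) &
      {within integral_set phi,
        continuous (fun alpha => fine (packing_spectrum phi alpha))}].
Proof.
split.
- exact: integral_set_itv.
- by move=> alpha Ia; rewrite packing_spectrumE.
- move=> t x y /set_mem Ix /set_mem Iy.
  have t01 : (0 : R) <= t%:num <= 1 by apply/andP; split.
  have := packing_spectrum_concave d_gt0 a_decr a_ge2 phi_cont t01 Ix Iy.
  set f := fun alpha => fine (packing_spectrum phi alpha) => concave_f.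
  change (- f (t%:num * (x : R) + (1 - t%:num) * (y : R))
    <= t%:num * (- f x) + (1 - t%:num) * (- f y)).
  by rewrite !mulrN -opprD lerN2.
- exact: packing_spectrum_continuous.
Qed.
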